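(* Let $\lambda$ be an admissible radial weight on the unit disc $\mathbb{D}\subset\mathbb{C}$; regard $\lambda$ also as a function on $[0,1]$, with $\lambda(z)=\lambda(|z|)$ for $z\in\mathbb{D}$. Suppose that (1) $\lambda(r)$ is a smooth function on $[0,1]$; (2) $\lambda^{(n)}(1):=\frac{d^n}{dr^n}\lambda(1)=0$ for every integer $n\ge 0$; (3) for every integer $n\geq 0$ there exists $a_n\in(0,1)$ such that $(-1)^n\lambda^{(n)}(r)$ is non-negative on the interval $(a_n,1)$. Then, for $p\in(1,\infty)$, the weighted Bergman projection $\mathbf{B}_{\lambda}$ is bounded from $L^p(\mathbb{D},\lambda)$ to $L^p(\mathbb{D},\lambda)$ only for $p=2$.
   Context: A weight on a domain $\Omega\subset\mathbb{C}^n$ is a non-negative measurable function $\mu$ on $\Omega$. For $p\in[1,\infty)$, $L^p(\Omega,\mu)$ is the space of measurable functions $f$ on $\Omega$ with $\|f\|_{p,\mu}^p=\int_\Omega |f|^p\mu\,dA<\infty$, where $dA$ is Lebesgue measure. $L^2_a(\Omega,\mu)$ is the subspace of holomorphic functions in $L^2(\Omega,\mu)$. The weight $\mu$ is admissible if for every compact $K\subset\Omega$ there is $C_K>0$ with $\sup_{z\in K}|f(z)|\le C_K\|f\|_{2,\mu}$ for all $f\in L^2_a(\Omega,\mu)$; then $L^2_a(\Omega,\mu)$ is closed in $L^2(\Omega,\mu)$. The weighted Bergman projection is the orthogonal projection $\mathbf{B}_{\Omega,\mu}:L^2(\Omega,\mu)\to L^2_a(\Omega,\mu)$; when $\Omega=\mathbb{D}$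 it is written $\mathbf{B}_\mu$. It is said to be bounded on $L^p(\Omega,\mu)$ if there is $C>0$ with $\|\mathbf{B}_{\Omega,\mu}f\|_{p,\mu}\le C\|f\|_{p,\mu}$ for all $f\in L^2(\Omega,\mu)\cap L^p(\Omega,\mu)$. *)

(* Defs.v *)
From HB Require Import structures.
From mathcomp Require Import all_boot all_order all_algebra.
From mathcomp Require Import complex.
From mathcomp Require Import all_classical all_reals all_analysis.
Import Order.TTheory GRing.Theory Num.Theory.
Import numFieldNormedType.Exports.

Set Implicit Arguments.
Unset Strict Implicit.
Unset Printing Implicit Defensive.

Local Open Scope classical_set_scope.
Local Open Scope ring_scope.
Local Open Scope complex_scope.

(* The regular module [R[i]^o] is the form of the complex numbers that carries
   the topology induced by the modulus. *)
Notation Cplx R := (R[i])^o.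

Definition modulus (R : realType) (z : Cplx R) : R := ComplexField.Normc.normc z.

Notation plane R := (measurableTypeR R * measurableTypeR R)%type.

Definition to_cplx (R : realType) (w : plane R) : Cplx R := w.1 +i* w.2.

Notation area R := (@lebesgue_measure R \x @lebesgue_measure R)%E.

Definition unit_disc (R : realType) : set (Cplx R) := [set z | modulus z < 1].

Definition area_dom (R : realType) (Omega : set (Cplx R)) : set (plane R) :=
  @to_cplx R @^-1` Omega.

Definition is_weight (R : realType) (Omega : set (Cplx R))
    (mu : Cplx R -> R) : Prop :=
  (forall z, Omega z -> 0 <= mu z) /\
  measurable_fun (area_dom Omega) (mu \o @to_cplx R).

Definition cmeasurable (R : realType) (Omega : set (Cplx R))
    (f : Cplx R -> Cplx R) : Prop :=
  measurable_fun (area_dom Omega) (fun w => complex.Re (f (to_cplx w))) /\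
  measurable_fun (area_dom Omega) (fun w => complex.Im (f (to_cplx w))).

(* Takes the value [+oo] when [f] is not p-integrable. *)
Definition wnorm (R : realType) (Omega : set (Cplx R)) (mu : Cplx R -> R)
    (p : R) (f : Cplx R -> Cplx R) : \bar R :=
  ((\int[area R]_(w in area_dom Omega)
      (modulus (f (to_cplx w)) `^ p * mu (to_cplx w))%:E) `^ p^-1)%E.

Definition wLp (R : realType) (Omega : set (Cplx R)) (mu : Cplx R -> R)
    (p : R) : set (Cplx R -> Cplx R) :=
  [set f | cmeasurable Omega f /\ (wnorm Omega mu p f < +oo)%E].

(* [derivable f z 1] is taken over the field [R[i]]: it is complex
   differentiability at [z]. *)
Definition holomorphic (R : realType) (Omega : set (Cplx R))
    (f : Cplx R -> Cplx R) : Prop :=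
  forall z, Omega z -> derivable f z 1.

Definition wL2a (R : realType) (Omega : set (Cplx R)) (mu : Cplx R -> R) :
    set (Cplx R -> Cplx R) :=
  [set f | holomorphic Omega f /\ wLp Omega mu 2 f].

Definition admissible (R : realType) (Omega : set (Cplx R))
    (mu : Cplx R -> R) : Prop :=
  forall K : set (Cplx R), compact K -> K `<=` Omega ->
  exists C : R, 0 < C /\
    forall f, wL2a Omega mu f -> forall z, K z ->
      ((modulus (f z))%:E <= C%:E * wnorm Omega mu 2 f)%E.

Definition winner (R : realType) (Omega : set (Cplx R)) (mu : Cplx R -> R)
    (f g : Cplx R -> Cplx R) : Cplx R :=
  let F w := f (to_cplx w) * conjc (g (to_cplx w)) * (mu (to_cplx w))%:C in
  Rintegral (area R) (area_dom Omega) (fun w => complex.Re (F w)) +i*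
  Rintegral (area R) (area_dom Omega) (fun w => complex.Im (F w)).

(* If [mu] is an admissible weight and [f] is in L^2, exactly one [g] satisfies
   this, up to its values outside [Omega]; the default value in [bergman_proj]
   is then never used. *)
Definition is_bergman_proj (R : realType) (Omega : set (Cplx R))
    (mu : Cplx R -> R) (f g : Cplx R -> Cplx R) : Prop :=
  wL2a Omega mu g /\
  forall h, wL2a Omega mu h -> winner Omega mu (fun z => f z - g z) h = 0.

Definition bergman_proj (R : realType) (Omega : set (Cplx R))
    (mu : Cplx R -> R) (f : Cplx R -> Cplx R) : Cplx R -> Cplx R :=
  xget (fun=> 0) [set g | is_bergman_proj Omega mu f g].

Definition bergman_bounded (R : realType) (Omega : set (Cplx R))
    (mu : Cplx R -> R) (p : R) : Prop :=
  exists C : R, 0 < C /\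
    forall f, wLp Omega mu 2 f -> wLp Omega mu p f ->
      (wnorm Omega mu p (bergman_proj Omega mu f) <=
       C%:E * wnorm Omega mu p f)%E.

Definition diff_quot (R : realType) (f : R -> R) (x y : R) : R :=
  (f y - f x) / (y - x).

(* The filter restricts [y] to [[0, 1]], so derivatives at [0] and [1] are
   one-sided and the values of [f] outside [[0, 1]] are irrelevant. *)
Definition deriv01 (R : realType) (f : R -> R) (x : R) : R :=
  lim (diff_quot f x y @[y --> within `[0, 1] x^']).

Definition deriv01n (R : realType) (n : nat) (f : R -> R) : R -> R :=
  iter n (@deriv01 R) f.

Definition smooth01 (R : realType) (f : R -> R) : Prop :=
  forall (n : nat) (x : R), x \in `[0, 1] ->
    cvg (diff_quot (deriv01n n f) x y @[y --> within `[0, 1] x^']).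

(* Main.v *)
(* Test the boundedness on the functions z^n |z|^(n(q-2)), where q is the
   exponent conjugate to p. By rotation invariance the projection of such a
   function is a multiple of z^n, and boundedness with constant C becomes a
   reverse Hoelder inequality M(pn)^(1/p) M(qn)^(1/q) <= C M(2n) between the
   moments M(x), the integral of |z|^x lambda over the disc.
   In the other direction, k integrations by parts, whose boundary terms vanish
   because lambda is flat at 1, give
   (x+2) ... (x+k+1) M(x) = M_k(x+k), where M_k is the moment of
   (-1)^k lambda^(k). This function is nonnegative near the unit circle, and
   admissibility bounds M(x) below by a multiple of b^x for every b < 1, so the
   part of M_k away from the circle is negligible and Hoelder's inequality gives
   M_k(2n+k) <= 4 M_k(pn+k)^(1/p) M_k(qn+k)^(1/q) for n large. Together,
   2^k <= 4 e C (p^(1/p) q^(1/q))^k for every k, whereas p^(1/p) q^(1/q) < 2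
   unless p = 2, by strict concavity of the logarithm. *)
Require Import Defs.
From HB Require Import structures.
From mathcomp Require Import all_boot all_order all_algebra.
From mathcomp Require Import complex ring lra.
From mathcomp Require Import all_classical all_reals all_analysis.
From mathcomp Require Import measurable_realfun.
Import Order.TTheory GRing.Theory Num.Theory.
Import numFieldNormedType.Exports.
Set Implicit Arguments.
Unset Strict Implicit.
Unset Printing Implicit Defensive.
Local Open Scope classical_set_scope.
Local Open Scope ring_scope.

(** * Goursat's theorem on rectangles *)

(** Holomorphy is complex differentiability at each point, with no continuity of the derivative
    given and no power series. The projection formula asks only one thing of a holomorphic [h]: the
    mean of [Re (h z / z ^+ n)] over a circle about 0 does not depend on the radius. Goursat's
    bisection argument, transported by the exponential, supplies this. Averaging over rotations then
    turns the inner product of [z ^+ n * g (modulus z)] with [h] into a constant times a purely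
    radial integral, and subtracting the right multiple of [z ^+ n] makes that integral vanish. No
    orthogonal expansion of [h] enters. Area is a product measure in Cartesian coordinates. Polar
    coordinates are replaced by two facts: rotations preserve area, and the integral of a radial
    function over the disc of radius t can be differentiated in t. *)

Section goursat.
Variable R : realType.
Implicit Types (U V : R -> R -> R) (f : R -> R) (a b c d e x y l h z t M : R).
Local Notation mu := (@lebesgue_measure R).

Definition frechet2 U (x0 y0 a b : R) : Prop :=
  forall e, 0 < e -> exists2 d : R, 0 < d & forall x y,
    `|x - x0| < d -> `|y - y0| < d ->
    `|U x y - U x0 y0 - a * (x - x0) - b * (y - y0)|
      <= e * (`|x - x0| + `|y - y0|).

Lemma frechet2_continuousr U x0 y0 a b :
  frechet2 U x0 y0 a b -> {for y0, continuous (U x0)}.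
Proof.
move=> dU; apply/cvgrPdist_le => /= e e0.
have [d d0 Ud] := dU 1 ltr01.
have b0 : 0 < 1 + `|b| by rewrite ltr_pwDl.
exists (Num.min d (e / (1 + `|b|))) => [|y /=].
  by rewrite /= lt_min d0 divr_gt0.
rewrite lt_min distrC => /andP[yd ye].
have := Ud x0 y _ yd; rewrite subrr normr0 => /(_ d0).
rewrite mulr0 subr0 add0r mul1r => H.
have : `|U x0 y - U x0 y0| <= `|y - y0| + `|b| * `|y - y0|.
  rewrite -normrM -[X in `|X|](subrK (b * (y - y0))).
  by rewrite (le_trans (ler_normD _ _))// lerD2r.
rewrite distrC => /le_trans; apply.
by rewrite -[X in X + _]mul1r -mulrDl mulrC -ler_pdivlMr// ltW.
Qed.

Lemma frechet2_swap U x0 y0 a b :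
  frechet2 U x0 y0 a b -> frechet2 (fun y x => U x y) y0 x0 b a.
Proof.
move=> dU e e0; have [d d0 Ud] := dU e e0; exists d => // x y xd yd.
by have := Ud y x yd xd; rewrite (addrAC _ (- (a * _))) (addrC `|y - _|).
Qed.

Lemma continuous_itv_integrable f a b :
  (forall x, a <= x <= b -> {for x, continuous f}) ->
  mu.-integrable `[a, b] (EFin \o f).
Proof.
move=> cf; apply: continuous_compact_integrable; first exact: segment_compact.
apply: continuous_in_subspaceT => x /set_mem /=; rewrite in_itv /=; exact: cf.
Qed.

Lemma Rintegral_itv_cst a b c :
  a <= b -> \int[mu]_(x in `[a, b]) c = c * (b - a).
Proof.
move=> ab; rewrite Rintegral_cst//= lebesgue_measure_itv/= lte_fin.
have [//|ba] := ltP a b; have -> : a = b by apply/le_anti/andP.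
by rewrite subrr.
Qed.

Lemma Rintegral_itv_cat f a c b : a <= c -> c <= b ->
  (forall x, a <= x <= b -> {for x, continuous f}) ->
  \int[mu]_(x in `[a, b]) f x =
  \int[mu]_(x in `[a, c]) f x + \int[mu]_(x in `[c, b]) f x.
Proof.
move=> ac cb cf; have fi := continuous_itv_integrable cf.
rewrite -(Rintegral_itv_obnd_cbnd (r := c)); last first.
  by apply: integrableS fi => //; apply: subset_itv; rewrite bnd_simp.
by rewrite -(@Rintegral_itvB _ f _ _ c fi) ?bnd_simp// addrCA subrr addr0.
Qed.

Definition Rintl (a l : R) f : R := \int[mu]_(x in `[a, a + l]) f x.

(** Compares the integrals along two opposite sides of a rectangle, where the integrands differ by
    nearly the constant [c]. *)
Lemma le_dist_Rintl f g a l c M : 0 <= l ->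
  (forall x, a <= x <= a + l -> {for x, continuous f}) ->
  (forall x, a <= x <= a + l -> {for x, continuous g}) ->
  (forall x, a <= x <= a + l -> `|f x - g x - c| <= M) ->
  `|Rintl a l f - Rintl a l g - c * l| <= M * l.
Proof.
move=> l0 cf cg fgM; rewrite /Rintl.
have al : a <= a + l by rewrite lerDl.
have fi := continuous_itv_integrable cf.
have gi := continuous_itv_integrable cg.
have ci (k : R) : mu.-integrable `[a, a + l] (EFin \o cst k).
  by apply: continuous_itv_integrable => x _; exact: cvg_cst.
have fgi : mu.-integrable `[a, a + l] (EFin \o (fun x => f x - g x)).
  exact: (integrableB _ fi gi).
have fgci : mu.-integrable `[a, a + l] (EFin \o (fun x => f x - g x - c)).
  exact: (integrableB _ fgi (ci c)).
have lE k : \int[mu]_(x in `[a, a + l]) k = k * l.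
  by rewrite Rintegral_itv_cst// addrAC subrr add0r.
rewrite -(RintegralB _ fi gi)// -(lE c) -(RintegralB _ fgi (ci c))//.
apply: (le_trans (le_normr_Rintegral _ fgci)) => //.
rewrite -(lE M); apply: le_Rintegral => //.
- exact: (integrable_norm fgci).
- exact: (ci M).
Qed.

(** The counterclockwise integral of V dy - U dx around the rectangle with lower left corner (x, y),
    or the outward flux of the field (V, U). The differentiability hypothesis of the bisection says
    that this field has zero divergence. *)
Definition circulation U V (x y l h : R) : R :=
  (Rintl y h (V (x + l)) - Rintl y h (V x)) +
  (Rintl x l (U ^~ (y + h)) - Rintl x l (U ^~ y)).

Lemma sum4_lt a b c d e :
  4 * a < e -> 4 * b < e -> 4 * c < e -> 4 * d < e -> a + b + c + d < e.
Proof. lra. Qed.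

Lemma nested_segments (x l : nat -> R) : (forall m, 0 <= l m) ->
  (forall m, x m <= x m.+1) -> (forall m, x m.+1 + l m.+1 <= x m + l m) ->
  exists c, forall m, x m <= c <= x m + l m.
Proof.
move=> l0 xi xd.
have xi' : {homo x : m n / (m <= n)%N >-> m <= n} by apply/nondecreasing_seqP.
have xd' : {homo (fun m => x m + l m) : m n / (m <= n)%N >-> n <= m}.
  by apply/nonincreasing_seqP.
have xle m n : x m <= x n + l n.
  have [mn|nm] := leqP m n; first by rewrite (le_trans (xi' _ _ mn))// lerDl.
  by rewrite (le_trans _ (xd' _ _ (ltnW nm)))// lerDl.
have ub n : ubound (range x) (x n + l n) by move=> _ [m _ <-]; exact: xle.
exists (sup (range x)) => m; apply/andP; split.
  by apply: ub_le_sup; [exists (x 0%N + l 0%N); exact: ub | exists m].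
by apply: ge_sup; [exists (x 0%N), 0%N | exact: ub].
Qed.

(* Bisection needs the differentiability of [U] and [V] only at each point, not
   the continuity of their derivatives. *)
Section bisection.
Variables (U V : R -> R -> R) (X Y L H : R).
Hypotheses (L0 : 0 <= L) (H0 : 0 <= H).
Hypothesis dUV : forall x y, X <= x <= X + L -> Y <= y <= Y + H ->
  exists a b c, frechet2 V x y a c /\ frechet2 U x y b (- a).

Let inrect x y l h :=
  [&& X <= x, x + l <= X + L, Y <= y, y + h <= Y + H, 0 <= l & 0 <= h].

Let cV x y : X <= x <= X + L -> Y <= y <= Y + H -> {for y, continuous (V x)}.
Proof.
by move=> hx hy; have [a [b [c [dV _]]]] := dUV hx hy;
  exact: frechet2_continuousr dV.
Qed.

Let cU x y : X <= x <= X + L -> Y <= y <= Y + H ->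
  {for x, continuous (U ^~ y)}.
Proof.
by move=> hx hy; have [a [b [c [_ dU]]]] := dUV hx hy;
  exact: frechet2_continuousr (frechet2_swap dU).
Qed.

Let Rintl_half f a l : 0 <= l ->
  (forall x, a <= x <= a + l -> {for x, continuous f}) ->
  Rintl a l f = Rintl a (l / 2) f + Rintl (a + l / 2) (l / 2) f.
Proof.
move=> l0 cf; rewrite /Rintl -addrA -splitr.
by apply: Rintegral_itv_cat => //; lra.
Qed.

(** The contributions of the interior sides cancel, so the four quarters add up to the whole and one
    of them carries at least a quarter of it. *)
Let circulation_quarter x y l h : inrect x y l h ->
  exists xy : R * R, inrect xy.1 xy.2 (l / 2) (h / 2) /\
    [/\ x <= xy.1, xy.1 + l / 2 <= x + l, y <= xy.2, xy.2 + h / 2 <= y + h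
      & `|circulation U V x y l h| <=
        4 * `|circulation U V xy.1 xy.2 (l / 2) (h / 2)|].
Proof.
move=> /and5P[h1 h2 h3 h4] /andP[h5 h6].
have l2 : 0 <= l / 2 by rewrite divr_ge0.
have h2' : 0 <= h / 2 by rewrite divr_ge0.
have xl : x + l / 2 <= x + l by rewrite lerD2l ler_pdivrMr// ler_peMr// ler1n.
have yh : y + h / 2 <= y + h by rewrite lerD2l ler_pdivrMr// ler_peMr// ler1n.
have xl2 : x + l / 2 + l / 2 <= x + l by rewrite -addrA -splitr.
have yh2 : y + h / 2 + h / 2 <= y + h by rewrite -addrA -splitr.
have xl0 : x <= x + l / 2 by rewrite lerDl.
have yh0 : y <= y + h / 2 by rewrite lerDl.
have found x' y' : x <= x' -> x' + l / 2 <= x + l ->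
    y <= y' -> y' + h / 2 <= y + h -> `|circulation U V x y l h| <=
        4 * `|circulation U V x' y' (l / 2) (h / 2)| ->
    exists xy : R * R, inrect xy.1 xy.2 (l / 2) (h / 2) /\
    [/\ x <= xy.1, xy.1 + l / 2 <= x + l, y <= xy.2, xy.2 + h / 2 <= y + h
      & `|circulation U V x y l h| <=
        4 * `|circulation U V xy.1 xy.2 (l / 2) (h / 2)|].
  move=> k1 k2 k3 k4 k5; exists (x', y'); split => //.
  by rewrite /inrect (le_trans h1 k1) (le_trans k2 h2) (le_trans h3 k3)
    (le_trans k4 h4) l2 h2'.
have : circulation U V x y l h =
    circulation U V x y (l / 2) (h / 2) +
    circulation U V (x + l / 2) y (l / 2) (h / 2) +
    circulation U V x (y + h / 2) (l / 2) (h / 2) +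
    circulation U V (x + l / 2) (y + h / 2) (l / 2) (h / 2).
  rewrite /circulation.
  have sp z : (z / 2 + z / 2 = z) by move=> *; field.
  rewrite -!(addrA _ (l / 2)) -!(addrA _ (h / 2)) !sp.
  rewrite (@Rintl_half (V (x + l)) y)//; last first.
    by move=> z hz; apply: cV; lra.
  rewrite (@Rintl_half (V x) y)//; last by move=> z hz; apply: cV; lra.
  rewrite (@Rintl_half (U ^~ (y + h)) x)//; last first.
    by move=> z hz; apply: cU; lra.
  rewrite (@Rintl_half (U ^~ y) x)//; last by move=> z hz; apply: cU; lra.
  by ring.
set E1 := circulation U V x y (l / 2) (h / 2).
set E2 := circulation U V (x + l / 2) y (l / 2) (h / 2).
set E3 := circulation U V x (y + h / 2) (l / 2) (h / 2).
set E4 := circulation U V (x + l / 2) (y + h / 2) (l / 2) (h / 2).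
move=> EE.
have : `|circulation U V x y l h| <= `|E1| + `|E2| + `|E3| + `|E4|.
  rewrite EE; have := ler_normD (E1 + E2 + E3) E4.
  by have := ler_normD (E1 + E2) E3; have := ler_normD E1 E2; lra.
move=> Ele.
have [e1|e1] := lerP `|circulation U V x y l h| (4 * `|E1|); first exact: found e1.
have [e2|e2] := lerP `|circulation U V x y l h| (4 * `|E2|); first exact: found e2.
have [e3|e3] := lerP `|circulation U V x y l h| (4 * `|E3|); first exact: found e3.
have [e4|e4] := lerP `|circulation U V x y l h| (4 * `|E4|); first exact: found e4.
by have := sum4_lt e1 e2 e3 e4; rewrite ltNge Ele.
Qed.

Let circulation_small c d a b k e : 0 < e ->
  frechet2 V c d a k -> frechet2 U c d b (- a) ->
  exists2 r : R, 0 < r & forall x y l h, inrect x y l h -> l < r -> h < r ->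
    x <= c <= x + l -> y <= d <= y + h ->
    `|circulation U V x y l h| <= 2 * e * (l + h) ^+ 2.
Proof.
move=> e0 dV dU; have [r r0 Vr] := dV e e0; have [s s0 Us] := dU e e0.
exists (Num.min r s) => [|x y l h]; first by rewrite lt_min r0.
rewrite !lt_min => /and5P[h1 h2 h3 h4] /andP[h5 h6] /andP[lr ls] /andP[hr hs].
move=> /andP[xc cx] /andP[yd dy].
have near z t w u : z <= t <= z + w -> z <= u <= z + w -> `|u - t| <= w.
  by move=> /andP[? ?] /andP[? ?]; rewrite ler_norml; apply/andP; split; lra.
have xcx : x <= c <= x + l by rewrite xc cx.
have ydy : y <= d <= y + h by rewrite yd dy.
have rem (F : R -> R -> R) (A B r' z z' t t' : R) :
    (forall x y, `|x - c| < r' -> `|y - d| < r' ->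
      `|F x y - F c d - A * (x - c) - B * (y - d)|
        <= e * (`|x - c| + `|y - d|)) -> l < r' -> h < r' ->
    x <= z <= x + l -> x <= z' <= x + l ->
    y <= t <= y + h -> y <= t' <= y + h ->
    `|F z t - F z' t' - A * (z - z') - B * (t - t')| <= 2 * e * (l + h).
  move=> FP lr' hr' /(near _ _ _ _ xcx) nz /(near _ _ _ _ xcx) nz'.
  move=> /(near _ _ _ _ ydy) nt /(near _ _ _ _ ydy) nt'.
  rewrite (_ : _ - _ = (F z t - F c d - A * (z - c) - B * (t - d)) -
      (F z' t' - F c d - A * (z' - c) - B * (t' - d))); last by ring.
  rewrite (le_trans (ler_normB _ _))//.
  have F1 := FP z t (le_lt_trans nz lr') (le_lt_trans nt hr').
  have F2 := FP z' t' (le_lt_trans nz' lr') (le_lt_trans nt' hr').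
  rewrite -mulrA mulr_natl mulr2n lerD//.
    by rewrite (le_trans F1)// ler_pM2l// lerD.
  by rewrite (le_trans F2)// ler_pM2l// lerD.
(* The first-order parts [a * l * h] and [(- a) * h * l] cancel because the divergence is zero. Each
   pair of opposite sides leaves at most [2 * e * (l + h)] per unit length. *)
rewrite (_ : circulation U V x y l h =
  (Rintl y h (V (x + l)) - Rintl y h (V x) - a * l * h) +
  (Rintl x l (U ^~ (y + h)) - Rintl x l (U ^~ y) - (- a) * h * l)); last first.
  by rewrite /circulation; ring.
rewrite (le_trans (ler_normD _ _))//.
rewrite (_ : 2 * e * (l + h) ^+ 2 =
  2 * e * (l + h) * h + 2 * e * (l + h) * l); last by ring.
have xx : x <= x <= x + l by rewrite lexx lerDl.
have xl : x <= x + l <= x + l by rewrite lexx lerDl h5.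
have yy : y <= y <= y + h by rewrite lexx lerDl.
have yh : y <= y + h <= y + h by rewrite lexx lerDl h6.
have inX z : x <= z <= x + l -> X <= z <= X + L.
  by move=> /andP[z1 z2]; rewrite (le_trans h1 z1) (le_trans z2 h2).
have inY z : y <= z <= y + h -> Y <= z <= Y + H.
  by move=> /andP[z1 z2]; rewrite (le_trans h3 z1) (le_trans z2 h4).
apply: lerD; apply: le_dist_Rintl => // z hz.
- exact: cV (inX _ xl) (inY _ hz).
- exact: cV (inX _ xx) (inY _ hz).
- have := rem V a k r (x + l) x z z Vr lr hr xl xx hz hz.
  by rewrite subrr mulr0 subr0 (addrAC x) subrr add0r.
- exact: cU (inX _ hz) (inY _ yh).
- exact: cU (inX _ hz) (inY _ yy).
- have := rem U b (- a) s z z (y + h) y Us ls hs hz hz yh yy.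
  by rewrite subrr mulr0 subr0 (addrAC y) subrr add0r.
Qed.

Lemma circulation_eq0 : circulation U V X Y L H = 0.
Proof.
apply/eqP; apply/negPn/negP => C0.
pose e : R := `|circulation U V X Y L H|.
have e0 : 0 < e by rewrite normr_gt0.
pose l m := L / 2 ^+ m; pose h m := H / 2 ^+ m.
(* The condition is an implication so that the choice of a quarter is total: outside the given
   rectangle any value will do. *)
have /choice[nx nxP] (t : nat * (R * R)) : exists u : R * R,
    inrect t.2.1 t.2.2 (l t.1) (h t.1) ->
    inrect u.1 u.2 (l t.1 / 2) (h t.1 / 2) /\
    [/\ t.2.1 <= u.1, u.1 + l t.1 / 2 <= t.2.1 + l t.1,
        t.2.2 <= u.2, u.2 + h t.1 / 2 <= t.2.2 + h t.1
      & `|circulation U V t.2.1 t.2.2 (l t.1) (h t.1)| <=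
        4 * `|circulation U V u.1 u.2 (l t.1 / 2) (h t.1 / 2)|].
  case: t => m [x y] /=.
  have [xyP|xyP] := pselect (inrect x y (l m) (h m)).
    by have [u uP] := circulation_quarter xyP; exists u.
  by exists (x, y).
pose S := fix S m := if m is m'.+1 then nx (m', S m') else (X, Y).
have lS m : l m.+1 = l m / 2 by rewrite /l exprS invfM; field; rewrite expf_neq0.
have hS m : h m.+1 = h m / 2 by rewrite /h exprS invfM; field; rewrite expf_neq0.
have l0 m : 0 <= l m by rewrite divr_ge0// exprn_ge0.
have h0 m : 0 <= h m by rewrite divr_ge0// exprn_ge0.
have SI m : inrect (S m).1 (S m).2 (l m) (h m).
  elim: m => [|m IH]; first by rewrite /= /inrect /l /h !expr0 !divr1 !lexx L0 H0.
  by have [+ _] := nxP (m, S m) IH; rewrite /= -lS -hS.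
have SE m : e <= 4 ^+ m * `|circulation U V (S m).1 (S m).2 (l m) (h m)|.
  elim: m => [|m IH]; first by rewrite /= /l /h !expr0 !divr1 mul1r.
  rewrite (le_trans IH)// exprSr -mulrA ler_pM2l ?exprn_gt0//.
  by have [_ [_ _ _ _]] := nxP (m, S m) (SI m); rewrite /= -lS -hS.
have [c cP] : exists c, forall m, (S m).1 <= c <= (S m).1 + l m.
  apply: (@nested_segments (fun m => (S m).1)) => // m;
    by have [_ []] := nxP (m, S m) (SI m); rewrite /= -?lS -?hS.
have [d dP] : exists d, forall m, (S m).2 <= d <= (S m).2 + h m.
  apply: (@nested_segments (fun m => (S m).2)) => // m;
    by have [_ []] := nxP (m, S m) (SI m); rewrite /= -?lS -?hS.
have [||a [b [k [dV dU]]]] := @dUV c d.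
- by have := cP 0%N; rewrite /= /l expr0 divr1.
- by have := dP 0%N; rewrite /= /h expr0 divr1.
(* [4 ^+ m] times the bound on the [m]-th rectangle is [2 * e' * (L + H) ^+ 2], which is below [e].
   The added 1 keeps the denominator positive when [L = H = 0]. *)
pose e' := e / (4 * ((L + H) ^+ 2 + 1)).
have LH0 : 0 < 4 * ((L + H) ^+ 2 + 1) by rewrite mulr_gt0// ltr_wpDl// sqr_ge0.
have e'0 : 0 < e' by rewrite divr_gt0.
have [r r0 rP] := circulation_small e'0 dV dU.
have [m mP] : exists m : nat, (L + H) / 2 ^+ m < r.
  have [m mP] : exists m : nat, (L + H) / r < m%:R.
    by exists (Num.truncn ((L + H) / r)).+1; rewrite truncnS_gt.
  exists m; rewrite ltr_pdivrMr ?exprn_gt0// mulrC -ltr_pdivrMr//.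
  by rewrite (lt_le_trans mP)// -natrX ler_nat ltnW// ltn_expl.
have lh : l m + h m = (L + H) / 2 ^+ m by rewrite /l /h mulrDl.
have := rP _ _ _ _ (SI m) _ _ (cP m) (dP m).
rewrite lh => /(_ (le_lt_trans _ mP) (le_lt_trans _ mP)).
have -> : l m <= (L + H) / 2 ^+ m by rewrite -lh lerDl.
have -> : h m <= (L + H) / 2 ^+ m by rewrite -lh lerDr.
move=> /(_ isT isT) Cm; have := SE m; rewrite leNgt => /negP; apply.
have p4 : (0 : R) < 4 ^+ m by rewrite exprn_gt0.
have -> : e = 4 * ((L + H) ^+ 2 + 1) * e'.
  by rewrite /e' mulrC divfK// lt0r_neq0.
rewrite mulrC -ltr_pdivlMr// (le_lt_trans Cm)//.
rewrite expr_div_n -exprM mulnC exprM (_ : 2 ^+ 2 = 4); last by ring.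
rewrite mulrA ltr_pM2r ?invr_gt0//.
have := sqr_ge0 (L + H); nra.
Qed.

Lemma Rintl_periodic : (forall x, U x (Y + H) = U x Y) ->
  Rintl Y H (V (X + L)) = Rintl Y H (V X).
Proof.
move=> UE; have := circulation_eq0; rewrite /circulation.
have -> : U ^~ (Y + H) = U ^~ Y by apply/funext.
by rewrite subrr addr0 => /eqP; rewrite subr_eq0 => /eqP.
Qed.

End bisection.
End goursat.

(** * Circle means of holomorphic functions *)

Section complex_exponential.
Variable R : realType.
Implicit Types (z t w : Cplx R).
Local Open Scope complex_scope.

Lemma normC_modulus z : `|z| = (modulus z)%:C.
Proof. by []. Qed.

Lemma modulusM z w : modulus (z * w) = modulus z * modulus w.
Proof. exact: ComplexField.Normc.normcM. Qed.

Lemma ler_modulusD z w : modulus (z + w) <= modulus z + modulus w.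
Proof. by rewrite -lecR rmorphD /= -!normC_modulus ler_normD. Qed.

Lemma modulusX z n : modulus (z ^+ n) = modulus z ^+ n.
Proof.
by apply: complexI; rewrite rmorphXn /= -!normC_modulus normrX.
Qed.

Lemma modulusE z : modulus z = Num.sqrt (complex.Re z ^+ 2 + complex.Im z ^+ 2).
Proof. by case: z. Qed.

Lemma modulus_ge0 z : 0 <= modulus z.
Proof. by rewrite modulusE sqrtr_ge0. Qed.

Lemma modulus0 : modulus (0 : Cplx R) = 0.
Proof. by apply: complexI; rewrite -normC_modulus normr0. Qed.

Lemma modulus_eq0 z : (modulus z == 0) = (z == 0).
Proof. by rewrite -(inj_eq (@complexI R)) -normC_modulus normr_eq0. Qed.

Lemma modulus_real (x : R) : modulus x%:C = `|x|.
Proof. by rewrite modulusE /= expr0n addr0 sqrtr_sqr. Qed.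

Lemma le_Re_modulus z : `|complex.Re z| <= modulus z.
Proof. by rewrite -lecR -normC_modulus normc_ge_Re. Qed.

Lemma le_Im_modulus z : `|complex.Im z| <= modulus z.
Proof.
by rewrite modulusE -sqrtr_sqr ler_wsqrtr // lerDr sqr_ge0.
Qed.

Lemma modulus_leD z : modulus z <= `|complex.Re z| + `|complex.Im z|.
Proof.
rewrite modulusE -[leRHS]ger0_norm ?addr_ge0// -sqrtr_sqr ler_wsqrtr//.
rewrite sqrrD -!normrX !(ger0_norm (sqr_ge0 _)).
by rewrite addrAC lerDl mulrn_wge0// mulr_ge0.
Qed.

Lemma ReD z w : complex.Re (z + w) = complex.Re z + complex.Re w.
Proof. by case: z w => [a b] [c d]. Qed.

Lemma ImD z w : complex.Im (z + w) = complex.Im z + complex.Im w.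
Proof. by case: z w => [a b] [c d]. Qed.

Lemma ReB z w : complex.Re (z - w) = complex.Re z - complex.Re w.
Proof. by case: z w => [a b] [c d]. Qed.

Lemma ImB z w : complex.Im (z - w) = complex.Im z - complex.Im w.
Proof. by case: z w => [a b] [c d]. Qed.

Lemma ReM z w : complex.Re (z * w) =
  complex.Re z * complex.Re w - complex.Im z * complex.Im w.
Proof. by case: z w => [a b] [c d]. Qed.

Lemma ImM z w : complex.Im (z * w) =
  complex.Re z * complex.Im w + complex.Im z * complex.Re w.
Proof. by case: z w => [a b] [c d]. Qed.

Definition ReImE := (ReB, ImB, ReD, ImD, ReM, ImM).

Definition cexp z : Cplx R :=
  (expR (complex.Re z) * cos (complex.Im z)) +i*
  (expR (complex.Re z) * sin (complex.Im z)).

Lemma cexpD z w : cexp (z + w) = cexp z * cexp w.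
Proof.
case: z w => [a b] [c d]; rewrite /cexp /= expRD cosD sinD; simpc.
by congr (_ +i* _); ring.
Qed.

Lemma modulus_cexp z : modulus (cexp z) = expR (complex.Re z).
Proof.
rewrite modulusE /= !exprMn -mulrDr cos2Dsin2 mulr1 sqrtr_sqr ger0_norm//.
Qed.

(** Stated over any [numFieldType] because it serves both real derivatives and derivatives over
    [R[i]]. *)
Lemma is_derive_expansion (K : numFieldType) (f : K^o -> K^o) (x D : K) :
  is_derive (x : K^o) 1 f D -> forall e, 0 < e ->
  exists2 d : K, 0 < d & forall t : K, `|t| < d ->
    `|f (x + t) - f x - D * t| <= e * `|t|.
Proof.
move=> [df dE] e e0.
have : h^-1 *: (f (h *: 1 + x) - f x) @[h --> (0 : K^o)^'] --> (D : K^o).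
  by rewrite -dE; exact: df.
move=> /cvgrPdist_le /(_ e e0) [d /= d0 dP]; exists d => // t td.
have [->|t0] := eqVneq t 0; first by rewrite addr0 subrr mulr0 subr0 normr0 mulr0.
have := dP t; rewrite /= sub0r normrN => /(_ td t0).
rewrite -(ler_pM2r (_ : 0 < `|t|)) ?normr_gt0// -normrM.
rewrite mulrBl /GRing.scale /= mulr1 mulrAC mulVf// mul1r distrC.
by rewrite (addrC t).
Qed.

Lemma expansion_is_derive (K : numFieldType) (f : K^o -> K^o) (x D : K) :
  (forall e, 0 < e ->
    exists2 d : K, 0 < d & forall t : K, `|t| < d ->
    `|f (x + t) - f x - D * t| <= e * `|t|) ->
  is_derive (x : K^o) 1 f D.
Proof.
move=> H.
have : h^-1 *: (f (h *: 1 + x) - f x) @[h --> (0 : K^o)^'] --> (D : K^o).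
  apply/cvgrPdist_le => e /H[d d0 dP]; exists d => //= t.
  rewrite /= sub0r normrN => td t0.
  rewrite -(ler_pM2r (_ : 0 < `|t|)) ?normr_gt0// -normrM.
  rewrite mulrBl /GRing.scale /= mulr1 mulrAC mulVf// mul1r distrC (addrC t).
  exact: dP.
by move=> c; apply: DeriveDef; [apply/cvg_ex; exists D | exact: cvg_lim].
Qed.

Lemma cexp_expansion0 e : 0 < e -> exists2 d : R, 0 < d &
  forall t, modulus t < d -> modulus (cexp t - 1 - t) <= e * modulus t.
Proof.
(* The remainders cost [3 * e1] in the real part and [5 * e1] in the imaginary part, times the
   modulus of [t]; hence the 8. Taking [modulus t < e1] absorbs the second-order product of
   [expR a - 1] and [sin b]. *)
move=> e0; have [e1 [e10 e11 e18]] : exists e1 : R, [/\ 0 < e1, e1 <= 1 & e1 <= e / 8].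
  exists (Num.min 1 (e / 8)); split; first by rewrite lt_min ltr01 divr_gt0.
    by rewrite ge_min lexx.
  by rewrite ge_min lexx orbT.
have [d1 d10 H1] := is_derive_expansion (is_derive_expR (0 : R)) e10.
have [d2 d20 H2] := is_derive_expansion (is_derive_sin (0 : R)) e10.
have [d3 d30 H3] := is_derive_expansion (is_derive_cos (0 : R)) e10.
exists (Num.min (Num.min d1 d2) (Num.min d3 (Num.min (1 / 2) e1))).
  by rewrite !lt_min d10 d20 d30 e10 divr_gt0.
case=> a b; rewrite !lt_min => /andP[/andP[t1 t2] /and3P[t3 t4 t5]].
set t := a +i* b in t1 t2 t3 t4 t5 *.
have at_ : `|a| <= modulus t by exact: (le_Re_modulus t).
have bt : `|b| <= modulus t by exact: (le_Im_modulus t).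
have := H1 a (le_lt_trans at_ t1); have := H2 b (le_lt_trans bt t2).
have := H3 b (le_lt_trans bt t3); rewrite !add0r expR0 cos0 sin0 oppr0 mul0r.
rewrite !mul1r subr0 addr0.
set E := expR a; set m := modulus t in t1 t2 t3 t4 t5 at_ bt *.
move=> Hc Hs HE.
have m0 : 0 <= m by exact: modulus_ge0.
have nE : `|E| <= 2.
  rewrite ger0_norm ?expR_ge0//; move: HE; rewrite ler_norml => /andP[_ HE].
  have := ler_norm a; nra.
have nE1 : `|E - 1| <= 2 * m.
  rewrite -(subrK a (E - 1)) (le_trans (ler_normD _ _))//.
  rewrite mulr_natl mulr2n lerD// (le_trans HE)//.
  by rewrite (le_trans _ at_)// ler_piMl.
have ns : `|sin b| <= 2 * m.
  rewrite -(subrK b (sin b)) (le_trans (ler_normD _ _))//.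
  rewrite mulr_natl mulr2n lerD// (le_trans Hs)//.
  by rewrite (le_trans _ bt)// ler_piMl.
have hRe : `|complex.Re (cexp t - 1 - t)| <= 3 * e1 * m.
  rewrite (_ : complex.Re _ = (E - 1 - a) + E * (cos b - 1)); last first.
    by rewrite !(ReB, ImB) /cexp /= -/E; ring.
  rewrite (le_trans (ler_normD _ _))// (_ : 3 * e1 * m = e1 * m + 2 * (e1 * m)).
    rewrite lerD//; first by rewrite (le_trans HE)// ler_pM2l.
    by rewrite normrM ler_pM// (le_trans Hc)// ler_pM2l.
  by ring.
have hIm : `|complex.Im (cexp t - 1 - t)| <= 5 * e1 * m.
  rewrite (_ : complex.Im _ = (E - 1) * sin b + (sin b - b)); last first.
    by rewrite !(ReB, ImB) /cexp /= -/E; ring.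
  rewrite (le_trans (ler_normD _ _))// (_ : 5 * e1 * m = 4 * e1 * m + e1 * m).
    rewrite lerD//; last by rewrite (le_trans Hs)// ler_pM2l.
    rewrite normrM (le_trans (ler_pM _ _ nE1 ns))//.
    by rewrite mulrA ler_wpM2r// mulrAC -natrM ler_wpM2l// ltW.
  by ring.
rewrite (le_trans (modulus_leD _))// (le_trans (lerD hRe hIm))//.
by rewrite -mulrDl ler_wpM2r//; move: e18; rewrite ler_pdivlMr//; lra.
Qed.

Lemma is_derive_cexp z : is_derive z 1 (cexp : Cplx R -> Cplx R) (cexp z).
Proof.
apply: (@expansion_is_derive R[i]) => -[e e'] /andP[/eqP /= -> e0].
have m0 : 0 < modulus (cexp z) by rewrite modulus_cexp expR_gt0.
have [d d0 H] := cexp_expansion0 (divr_gt0 e0 m0).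
exists d%:C; first by rewrite ltcR.
move=> t; rewrite !normC_modulus ltcR => /H.
have -> : cexp (z + t) - cexp z - cexp z * t = cexp z * (cexp t - 1 - t).
  by rewrite cexpD !mulrBr mulr1.
rewrite -[e +i* 0]/(e%:C) -rmorphM lecR modulusM mulrAC ler_pdivlMr//.
by rewrite mulrC.
Qed.

Lemma cexp_surj w : w != 0 ->
  exists2 z, cexp z = w & complex.Re z = ln (modulus w).
Proof.
move=> w0; have m0 : 0 < modulus w.
  by rewrite lt_neqAle modulus_ge0 eq_sym modulus_eq0 w0.
pose c := complex.Re w / modulus w.
have c1 : -1 <= c <= 1.
  rewrite -ler_norml normrM normfV [`|modulus w|]gtr0_norm//.
  by rewrite ler_pdivrMr// mul1r le_Re_modulus.
have cE : modulus w * c = complex.Re w by rewrite mulrC divfK// gt_eqF.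
have sE : modulus w * Num.sqrt (1 - c ^+ 2) = `|complex.Im w|.
  rewrite -[X in X * _]gtr0_norm// -!sqrtr_sqr -sqrtrM ?sqr_ge0//.
  congr Num.sqrt; rewrite mulrBr mulr1 -exprMn cE [in LHS]modulusE sqr_sqrtr.
    by rewrite addrAC subrr add0r.
  by rewrite addr_ge0// sqr_ge0.
(* [acos] yields only angles in [0, pi]; points of the lower half-plane take the opposite angle. *)
exists (ln (modulus w) +i* (if 0 <= complex.Im w then acos c else - acos c)) => //.
rewrite /cexp /= lnK ?posrE//; case: ifP => im.
  rewrite acosK// sin_acos// cE sE ger0_norm//.
  by case: (w).
rewrite cosN sinN acosK// sin_acos// mulrN cE sE ltr0_norm ?opprK.
  by case: (w).
by rewrite ltNge im.
Qed.

Lemma cexp2pi z : cexp (z + (0 +i* (pi *+ 2))) = cexp z.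
Proof. by case: z => a b; rewrite /cexp /= addr0 cosD2pi sinD2pi. Qed.

End complex_exponential.

Lemma derivable1_comp (K : numFieldType) (f g : K^o -> K^o) (x : K) :
  derivable f (g x) 1 -> derivable g x 1 -> derivable (f \o g) (x : K^o) 1.
Proof.
move=> /derivable1_diffP df /derivable1_diffP dg; apply/derivable1_diffP.
exact: differentiable_comp.
Qed.

Section circle_means.
Variable R : realType.
Implicit Types (z t w : Cplx R).
Local Open Scope complex_scope.

Definition cis (y : R) : Cplx R := cos y +i* sin y.

Lemma cexp_im (y : R) : cexp (0 +i* y) = cis y.
Proof. by rewrite /cexp /= expR0 !mul1r. Qed.

Lemma modulus_cis (y : R) : modulus (cis y) = 1.
Proof. by rewrite -cexp_im modulus_cexp expR0. Qed.

(** The direction [c] is an arbitrary complex number because the logarithms of two points may differ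
    in their imaginary parts too. The factor [m] lets one lemma serve both components of the
    field. *)
Lemma frechet2_Re_affine (g : Cplx R -> Cplx R) (z0 c m D : Cplx R) (x0 y0 : R) :
  is_derive (z0 + c * x0%:C + (0 +i* y0)) 1 (g : Cplx R -> Cplx R) D ->
  frechet2 (fun x y => complex.Re (m * g (z0 + c * x%:C + (0 +i* y)))) x0 y0
    (complex.Re (m * D * c)) (complex.Re (m * D * 'i)).
Proof.
set z := (X in is_derive X) => /(@is_derive_expansion R[i]) dg e e0.
(* The increment of the argument is at most [modulus c + 1] times [|x - x0| + |y - y0|], and
   multiplication by [m] costs the other factor. The added ones avoid division by zero. *)
pose M : R := (modulus m + 1) * (modulus c + 1).
have M0 : 0 < M by rewrite mulr_gt0// ltr_wpDl// modulus_ge0.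
have eM0 : 0 < e / M by rewrite divr_gt0.
have [|[d d'] /andP[/eqP /= -> d0] dP] := dg (e / M)%:C; first by rewrite ltcR.
exists (d / (modulus c + 1)).
  by rewrite divr_gt0// ltr_wpDl// modulus_ge0.
move=> x y xd yd.
pose t : Cplx R := c * (x - x0)%:C + (0 +i* (y - y0)).
have tE : z0 + c * x%:C + (0 +i* y) = z + t.
  by rewrite /z /t; apply/eqP; rewrite eq_complex !ReImE /=;
    apply/andP; split; apply/eqP; ring.
have c1 : 0 < modulus c + 1 by rewrite ltr_wpDl// modulus_ge0.
have tle : modulus t <= modulus c * `|x - x0| + `|y - y0|.
  rewrite (le_trans (ler_modulusD _ _))// lerD//.
    by rewrite modulusM modulus_real.
  by rewrite modulusE /= expr0n add0r sqrtr_sqr.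
have td : modulus t < d.
  rewrite (le_lt_trans tle)// -[ltRHS](divfK (lt0r_neq0 c1)) mulrDr mulr1.
  by rewrite ler_ltD// mulrC ler_wpM2r ?modulus_ge0// ltW.
have := dP t; rewrite normC_modulus ltcR => /(_ td).
rewrite -tE normC_modulus -rmorphM lecR => H.
have -> : complex.Re (m * g (z0 + c * x%:C + (0 +i* y))) - complex.Re (m * g z) -
    complex.Re (m * D * c) * (x - x0) - complex.Re (m * D * 'i) * (y - y0) =
    complex.Re (m * (g (z0 + c * x%:C + (0 +i* y)) - g z - D * t)).
  by rewrite /t !ReImE /=; ring.
rewrite (le_trans (le_Re_modulus _))// modulusM.
have mM : (modulus m + 1) * (e / M * modulus t) <= e * (`|x - x0| + `|y - y0|).
  rewrite mulrCA -mulrA /M invfM -mulrA ler_pM2l//.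
  have -> : (modulus m + 1)^-1 * ((modulus c + 1)^-1 * ((modulus m + 1) * modulus t)) =
    modulus t / (modulus c + 1).
    by field; rewrite !gt_eqF// ltr_wpDl// modulus_ge0.
  rewrite ler_pdivrMr// (le_trans tle)// mulrDl mulrDr mulr1 mulrC.
  have := modulus_ge0 c; have := normr_ge0 (x - x0); have := normr_ge0 (y - y0).
  nra.
rewrite (le_trans _ mM)// ler_pM ?modulus_ge0//.
by rewrite lerDl.
Qed.

Lemma Re_log_lt0 w z : unit_disc w -> cexp z = w -> complex.Re z < 0.
Proof.
move=> + zw; rewrite -zw => zD; have : modulus (cexp z) < 1 := zD.
by rewrite modulus_cexp expR_lt1.
Qed.

Lemma is_derive_quotient_cexp (h : Cplx R -> Cplx R) n z :
  holomorphic (@unit_disc R) h -> complex.Re z < 0 ->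
  exists D, is_derive z 1
    (((fun z => h z / z ^+ n) : Cplx R -> Cplx R) \o @cexp R) D.
Proof.
move=> hh z0; pose k : Cplx R -> Cplx R := fun z => h z / z ^+ n.
have cz : cexp z != 0.
  by rewrite -modulus_eq0 modulus_cexp gt_eqF// expR_gt0.
have dk : derivable (k : Cplx R -> Cplx R) (cexp z) 1.
  apply: (@derivableM R[i] (Cplx R) h (fun z => (z ^+ n)^-1)).
    by apply: hh; change (modulus (cexp z) < 1); rewrite modulus_cexp expR_lt1.
  apply: (@derivableV R[i] (Cplx R) (fun z => z ^+ n)).
    by rewrite expf_neq0.
  exact: exprn_derivable.
exists ('D_1 (k \o @cexp R : Cplx R -> Cplx R) z); apply: derivableP.
apply: (@derivable1_comp R[i] k (@cexp R) z dk).
by have [] := is_derive_cexp z.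
Qed.

Lemma holomorphic_circle_continuous (h : Cplx R -> Cplx R) n w (y : R) :
  holomorphic (@unit_disc R) h -> unit_disc w -> w != 0 ->
  {for y, continuous (fun y => complex.Re (h (cis y * w) / (cis y * w) ^+ n))}.
Proof.
move=> hh wD /cexp_surj[z zE _].
pose k : Cplx R -> Cplx R := fun z => h z / z ^+ n.
pose Z (x y : R) : Cplx R := z + 0 * x%:C + (0 +i* y).
have ZE (v : R) : Z 0 v = z + (0 +i* v) by rewrite /Z mul0r addr0.
have z0 : complex.Re (Z 0 y) < 0.
  by rewrite ZE ReD /= addr0 (Re_log_lt0 wD zE).
have [D Dg] := is_derive_quotient_cexp n hh z0.
have := frechet2_continuousr (@frechet2_Re_affine _ z 0 1 D 0 y Dg).
have -> : (fun v => complex.Re (1 * (k \o @cexp R) (z + 0 * 0%:C + (0 +i* v)))) =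
    (fun v => complex.Re (h (cis v * w) / (cis v * w) ^+ n)).
  apply/funext => v.
  by rewrite -/(Z 0 v) ZE mul1r /= cexpD zE cexp_im mulrC.
by [].
Qed.

(* The logarithm maps the two circles to vertical segments of length [2 pi]; the
   integrals over the horizontal sides of the rectangle between them cancel by
   periodicity. *)
Lemma holomorphic_circle_mean (h : Cplx R -> Cplx R) n w0 w1 :
  holomorphic (@unit_disc R) h -> unit_disc w0 -> unit_disc w1 ->
  w0 != 0 -> w1 != 0 ->
  Rintl 0 (pi *+ 2) (fun y => complex.Re (h (cis y * w0) / (cis y * w0) ^+ n)) =
  Rintl 0 (pi *+ 2) (fun y => complex.Re (h (cis y * w1) / (cis y * w1) ^+ n)).
Proof.
move=> hh w0D w1D /cexp_surj[z0 z0E rz0] /cexp_surj[z1 z1E rz1].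
pose k : Cplx R -> Cplx R := fun z => h z / z ^+ n.
pose g : Cplx R -> Cplx R := k \o @cexp R.
have lnD w z : unit_disc w -> cexp z = w -> complex.Re z < 0.
  exact: Re_log_lt0.
have dg z : complex.Re z < 0 -> exists D, is_derive z 1 (g : Cplx R -> Cplx R) D.
  exact: is_derive_quotient_cexp.
pose c : Cplx R := z1 - z0.
pose Z (x y : R) : Cplx R := z0 + c * x%:C + (0 +i* y).
have ZD x y : 0 <= x <= 0 + 1 -> complex.Re (Z x y) < 0.
  move=> /andP[x0 x1]; rewrite /Z /c !ReImE /=.
  have := lnD _ _ w0D z0E; have := lnD _ _ w1D z1E; nra.
(* The x-derivative of [V] is the real part of [D * c], with [D] the derivative of [g]. The factor
   ['i * c] in [U] makes its y-derivative the real part of ['i * c * D * 'i], which is the opposite: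
   the divergence is zero. *)
pose V x y := complex.Re (1 * g (Z x y)).
pose U x y := complex.Re ('i * c * g (Z x y)).
have UE x : U x (0 + pi *+ 2) = U x 0.
  rewrite add0r /U /g /= -[in RHS]cexp2pi; congr (complex.Re (_ * k (cexp _))).
  by apply/eqP; rewrite eq_complex /Z !ReImE /= !addr0 !eqxx.
have pi20 : 0 <= pi *+ 2 :> R by rewrite mulrn_wge0// pi_ge0.
have C := @Rintl_periodic R U V 0 0 1 (pi *+ 2) ler01 pi20 _ UE.
have VE x : V x = fun y => complex.Re (k (cis y * cexp (Z x 0))).
  apply/funext => y; rewrite /V mul1r /g /= -cexp_im -cexpD /Z.
  congr (complex.Re (k (cexp _))).
  by apply/eqP; rewrite eq_complex !ReImE /= add0r !addr0 eqxx/= addrC.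
have Z0 : Z 0 0 = z0.
  by apply/eqP; rewrite eq_complex /Z !ReImE /= !mulr0 subrr !addr0 !eqxx.
have Z1 : Z 1 0 = z1.
  apply/eqP; rewrite eq_complex /Z /c !ReImE /= !mulr0 !mulr1.
  by apply/andP; split; apply/eqP; ring.
have IE w x : cexp (Z x 0) = w ->
    Rintl 0 (pi *+ 2) (fun y => complex.Re (h (cis y * w) / (cis y * w) ^+ n)) =
    Rintl 0 (pi *+ 2) (V x).
  by move=> <-; rewrite VE.
have E0 : cexp (Z 0 0) = w0 by rewrite Z0.
have E1 : cexp (Z (0 + 1) 0) = w1 by rewrite add0r Z1.
suff /C CE : forall x y, 0 <= x <= 0 + 1 -> 0 <= y <= 0 + pi *+ 2 ->
    exists a b d, frechet2 V x y a d /\ frechet2 U x y b (- a).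
  exact: (etrans (IE w0 0 E0) (etrans (esym CE) (esym (IE w1 (0 + 1) E1)))).
move=> x y xD _.
have [D Dg] := dg _ (ZD x y xD).
exists (complex.Re (1 * D * c)), (complex.Re ('i * c * D * c)),
  (complex.Re (1 * D * 'i)); split; first exact: frechet2_Re_affine.
have -> : - complex.Re (1 * D * c) = complex.Re ('i * c * D * 'i).
  by rewrite !ReImE /=; ring.
exact: frechet2_Re_affine.
Qed.
End circle_means.

(** * Rotations and radial integrals *)

Section area_maps.
Variable R : realType.
Local Notation mu := (@lebesgue_measure R).
Implicit Types (A : set (measurableTypeR R)) (X : set (plane R)).

Lemma measurable_affine (c a : R) :
  measurable_fun setT ((fun x => c * x + a) : measurableTypeR R -> measurableTypeR R).
Proof. by apply: measurable_funD => //; exact: measurable_funM. Qed.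

(** Both sides are measures that give each half-open interval its length, which determines Lebesgue
    measure. *)
Lemma lebesgue_measure_affine (c a : R) A : 0 < c -> measurable A ->
  (c%:E * mu ((fun x => c * x + a)%R @^-1` A))%E = mu A.
Proof.
move=> c0 mA.
pose f : measurableTypeR R -> measurableTypeR R := fun x => c * x + a.
have mf : measurable_fun setT f by exact: measurable_affine.
have : pushforward (mscale (NngNum (ltW c0)) mu) f A = mu A.
  apply/esym; apply: lebesgue_measure_unique => // _ [[x y] /= xy <-].
  rewrite /pushforward /mscale /=.
  have -> : f @^-1` `]x, y] = `](x - a) / c, (y - a) / c]%classic.
    apply/seteqP; split => z; rewrite /= !in_itv/= => /andP[h1 h2];
      apply/andP; split.
    - by rewrite ltr_pdivrMr// ltrBlDr mulrC.
    - by rewrite ler_pdivlMr// lerBrDr mulrC.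
    - by move: h1; rewrite ltr_pdivrMr// ltrBlDr mulrC.
    - by move: h2; rewrite ler_pdivlMr// lerBrDr mulrC.
  rewrite !lebesgue_measure_itv/= !lte_fin ltr_pM2r ?invr_gt0// ltrD2r.
  case: ifP => _; last by rewrite mule0.
  by rewrite -!EFinB -EFinM; congr EFin; field; rewrite gt_eqF.
by [].
Qed.

(** [area] integrates the sections at fixed abscissa, which a vertical shear translates; a
    horizontal shear translates the sections at fixed ordinate. *)
Lemma product_measure12 X : measurable X ->
  area R X = (\int[mu]_y mu (ysection X y))%E.
Proof.
move=> mX; apply: (@product_measure_unique _ _ _ _ _ mu mu (mu \x^ mu)%E) => //.
by move=> A B mA mB; exact: product_measure2E.
Qed.

Definition affine2 (a b c d : R) (w : plane R) : plane R :=
  (a * w.1 + b * w.2, c * w.1 + d * w.2).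

Lemma measurable_affine2 a b c d : measurable_fun setT (affine2 a b c d).
Proof.
by apply: measurable_fun_pair => /=; apply: measurable_funD => //;
  apply: measurable_funM.
Qed.

Lemma measurable_affine2_preimage a b c d X : measurable X ->
  measurable (affine2 a b c d @^-1` X).
Proof. by move=> mX; rewrite -[X in measurable X]setTI; exact: measurable_affine2. Qed.

Lemma area_shear2 c X : measurable X -> area R (affine2 1 0 c 1 @^-1` X) = area R X.
Proof.
move=> mX; apply: eq_integral => x _ /=.
rewrite -[RHS](@lebesgue_measure_affine 1 (c * x))//; last exact: measurable_xsection.
rewrite mul1e; congr mu; apply/seteqP; split => y;
  by rewrite !xsectionE /= /affine2 /= !mul1r mul0r addr0 addrC.
Qed.

Lemma area_shear1 b X : measurable X -> area R (affine2 1 b 0 1 @^-1` X) = area R X.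
Proof.
move=> mX; rewrite !product_measure12//; last exact: measurable_affine2_preimage.
apply: eq_integral => y _ /=.
rewrite -[RHS](@lebesgue_measure_affine 1 (b * y))//; last exact: measurable_ysection.
rewrite mul1e; congr mu; apply/seteqP; split => x;
  by rewrite !ysectionE /= /affine2 /= !mul1r mul0r add0r.
Qed.

Lemma affine2_comp a b c d a' b' c' d' w :
  affine2 a b c d (affine2 a' b' c' d' w) =
  affine2 (a * a' + b * c') (a * b' + b * d') (c * a' + d * c') (c * b' + d * d') w.
Proof. by rewrite /affine2 /=; congr (_, _); ring. Qed.

(* A rotation with [s != 0] is a product of three shears. *)
Lemma area_rotation c s X : c ^+ 2 + s ^+ 2 = 1 -> measurable X ->
  area R (affine2 c (- s) s c @^-1` X) = area R X.
Proof.
have main c' s' X' : c' ^+ 2 + s' ^+ 2 = 1 -> s' != 0 -> measurable X' ->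
    area R (affine2 c' (- s') s' c' @^-1` X') = area R X'.
  (* [t] is the tangent of half the angle. *)
  move=> cs s0 mX; pose t := (1 - c') / s'.
  have sE : s' * s' = 1 - c' * c' by rewrite -!expr2 -cs; ring.
  have -> : affine2 c' (- s') s' c' @^-1` X' =
      affine2 1 (- t) 0 1 @^-1` (affine2 1 0 s' 1 @^-1` (affine2 1 (- t) 0 1 @^-1` X')).
    apply/seteqP; split => w /=; rewrite !affine2_comp /t;
      rewrite (_ : affine2 _ _ _ _ w = affine2 c' (- s') s' c' w)//;
      congr (affine2 _ _ _ _ w); field : sE => //.
  have m1 := measurable_affine2_preimage 1 (- t) 0 1 mX.
  have m2 := measurable_affine2_preimage 1 0 s' 1 m1.
  by rewrite (area_shear1 _ m2) (area_shear2 _ m1) (area_shear1 _ mX).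
move=> cs mX; have [s0|s0] := eqVneq s 0; last exact: main.
move: cs; rewrite s0 expr0n addr0 => /eqP; rewrite sqrf_eq1 => /orP[]/eqP ->.
  by congr (area R _); apply/seteqP; split => -[x y];
    rewrite /= /affine2 /= oppr0 !mul0r !mul1r addr0 add0r.
(* The half-turn remains; it is the square of the quarter-turn, to which [main] applies. *)
have c01 : 0 ^+ 2 + 1 ^+ 2 = 1 :> R by rewrite expr0n expr1n add0r.
have n10 : 1 != 0 :> R by rewrite oner_eq0.
have mX' := measurable_affine2_preimage 0 (- 1) 1 0 mX.
rewrite -(main 0 1 X c01 n10 mX) -(main 0 1 _ c01 n10 mX') oppr0.
congr (area R _); apply/seteqP; split => w /=; rewrite !affine2_comp;
  by rewrite !(mul0r, mulr0, mul1r, mulr1, add0r, addr0).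
Qed.

Lemma area_scale t X : 0 < t -> measurable X ->
  ((t ^+ 2)%:E * area R (affine2 t 0 0 t @^-1` X))%E = area R X.
Proof.
move=> t0 mX.
have : pushforward (mscale (NngNum (sqr_ge0 t)) (area R)) (affine2 t 0 0 t) X = area R X.
  apply/esym; apply: product_measure_unique => //.
    exact: measurable_affine2.
  move=> mS A B mA mB.
  change (((t ^+ 2)%:E * area R (affine2 t 0 0 t @^-1` (A `*` B)))%E = (mu A * mu B)%E).
  have -> : affine2 t 0 0 t @^-1` (A `*` B) =
      ((fun x => t * x + 0) @^-1` A) `*` ((fun x => t * x + 0) @^-1` B).
    by apply/seteqP; split => -[x y]; rewrite /affine2 /= !mul0r addr0 add0r addr0.
  have mp (C : set (measurableTypeR R)) : measurable C ->
      measurable ((fun x => t * x + 0) @^-1` C : set (measurableTypeR R)).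
    by move=> mC; rewrite -[X in measurable X]setTI; exact: measurable_affine.
  rewrite product_measure1E; [|exact: mp..].
  rewrite -(lebesgue_measure_affine 0 t0 mA) -(lebesgue_measure_affine 0 t0 mB).
  by rewrite expr2 EFinM muleACA.
by [].
Qed.
End area_maps.

(* The library derives the sigma-finiteness of a product only for
   (sub)probabilities: its general instance is shadowed. *)
Definition area_measure (R : realType) : set (plane R) -> \bar R := area R.

HB.instance Definition _ (R : realType) :=
  Measure.copy (@area_measure R) (area R).

Lemma area_sigma_finite (R : realType) : sigma_finite setT (@area_measure R).
Proof.
have /sigma_finiteP[F [TF ndF Foo]] := sigma_finiteT (@lebesgue_measure R).
exists (fun n => F n `*` F n) => [|k].
  rewrite -setXTT TF predeqE => -[x y]; split.
    move=> [/= [n _ Fnx] [k _ Fky]]; exists (maxn n k) => //; split.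
    - by move: x Fnx; exact/subsetPset/ndF/leq_maxl.
    - by move: y Fky; exact/subsetPset/ndF/leq_maxr.
  by move=> [n _ []/= ? ?]; split; exists n.
have [mF Fy] := Foo k; split; first exact: measurableX.
by rewrite /area_measure product_measure1E// lte_mul_pinfty// ge0_fin_numE.
Qed.

HB.instance Definition _ (R : realType) :=
  Measure_isSigmaFinite.Build _ _ _ (@area_measure R) (@area_sigma_finite R).

Section rotation_average.
Variable R : realType.
Local Notation mu := (@lebesgue_measure R).
Local Open Scope complex_scope.

Definition rot (y : R) : plane R -> plane R :=
  affine2 (cos y) (- sin y) (sin y) (cos y).

Lemma to_cplx_rot y w : to_cplx (rot y w) = cis y * to_cplx w.
Proof.
apply/eqP; rewrite eq_complex !ReImE /=.
by apply/andP; split; apply/eqP; ring.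
Qed.

Lemma measurable_rot2 :
  measurable_fun setT (fun u : plane R * measurableTypeR R => rot u.2 u.1).
Proof.
have mc (f : R -> R) : continuous f ->
    measurable_fun setT (fun u : plane R * measurableTypeR R => f u.2).
  by move=> cf; apply: measurableT_comp => //; exact: continuous_measurable_fun.
have m1 : measurable_fun setT (fun u : plane R * measurableTypeR R => u.1.1).
  exact: measurableT_comp.
have m2 : measurable_fun setT (fun u : plane R * measurableTypeR R => u.1.2).
  exact: measurableT_comp.
have mcos := mc _ (@continuous_cos R); have msin := mc _ (@continuous_sin R).
apply: measurable_fun_pair => /=; apply: measurable_funD;
  by apply: measurable_funM => //; exact: measurableT_comp.
Qed.

Lemma ge0_integral_rot y (f : plane R -> \bar R) :
  measurable_fun setT f -> (forall w, 0 <= f w)%E ->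
  (\int[area R]_w f (rot y w) = \int[area R]_w f w)%E.
Proof.
move=> mf f0.
have mr : measurable_fun setT (rot y) by exact: measurable_affine2.
have := @ge0_integral_pushforward _ _ _ _ R (rot y) mr (area R) setT f measurableT mf
  (fun w _ => f0 w).
rewrite preimage_setT => <-.
apply: eq_measure_integral => // A mA _.
by apply: area_rotation => //; exact: cos2Dsin2.
Qed.

Lemma integral_rot y (f : plane R -> \bar R) : measurable_fun setT f ->
  (\int[area R]_w f (rot y w) = \int[area R]_w f w)%E.
Proof.
move=> mf.
have Ep := @ge0_integral_rot y (f^\+)%E (measurable_funepos mf) (funepos_ge0 f).
have En := @ge0_integral_rot y (f^\-)%E (measurable_funeneg mf) (funeneg_ge0 f).
rewrite [RHS]integralE -Ep -En [LHS]integralE.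
congr (_ - _)%E; apply: eq_integral => w _.
  by rewrite (funepos_comp f (rot y)).
by rewrite (funeneg_comp f (rot y)).
Qed.

(** Fubini on the product of the plane with an interval of angles: for each fixed angle the rotation
    preserves area. *)
Lemma Rintegral_rotation_average (G : plane R -> R) :
  (area R).-integrable setT (EFin \o G) ->
  Rintegral (area R) setT (fun w => Rintl 0 (pi *+ 2) (fun y => G (rot y w))) =
  pi *+ 2 * Rintegral (area R) setT G.
Proof.
move=> iG; have mG : measurable_fun setT G.
  by apply/measurable_EFinP; case/integrableP: iG.
have pi20 : 0 <= pi *+ 2 :> R by rewrite mulrn_wge0// pi_ge0.
pose J : set (measurableTypeR R) := `[0, 0 + pi *+ 2]%classic.
have mJ : measurable J by exact: measurable_itv.
have muJ : mu J = (pi *+ 2)%:E.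
  apply: (etrans (lebesgue_measure_itv `[0%R, 0 + pi *+ 2])).
  by rewrite /= add0r lte_fin oppr0 adde0 mulrn_wgt0// pi_gt0.
pose f (u : plane R * measurableTypeR R) : \bar R :=
  (G (rot u.2 u.1) * \1_J u.2)%:E.
have mf : measurable_fun setT f.
  apply/measurable_EFinP; apply: measurable_funM => /=.
    by apply: (measurableT_comp mG); exact: measurable_rot2.
  by apply: (measurableT_comp (f := \1_J : measurableTypeR R -> R)).
have fy : (\int[mu]_y \int[area R]_w `|f (w, y)| < +oo)%E.
  have absE y : (\int[area R]_w `|f (w, y)| =
      \int[area R]_w `|(G w)%:E| * (\1_J y)%:E)%E.
    have mabsG : measurable_fun setT (abse \o (EFin \o G)).
      by apply: measurableT_comp => //; exact/measurable_EFinP.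
    rewrite -(@ge0_integral_rot y _ mabsG (fun w => abse_ge0 _)).
    rewrite -ge0_integralZr//; last 2 first.
    - by apply: (measurableT_comp mabsG); exact: measurable_affine2.
    - by move=> w _; exact: abse_ge0.
    apply: eq_integral => w _; rewrite /f /= normrM EFinM.
    by rewrite [`|\1_J y|]ger0_norm.
  under eq_integral do rewrite absE.
  rewrite ge0_integralZl//; last 2 first.
  - by apply/measurable_EFinP.
  - by apply: integral_ge0.
  rewrite integral_indic// setIT lte_mul_pinfty ?integral_ge0//.
    by rewrite ge0_fin_numE ?integral_ge0//; case/integrableP: iG.
  by apply: (@eq_ind_r _ _ (fun x => x < +oo)%E _ _ muJ); rewrite ltry.
have if_ := proj2 (@integrable21ltyP _ _ _ _ R (@area_measure R) mu f mf) fy.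
have FE w : (\int[mu]_y f (w, y) = \int[mu]_(y in J) (G (rot y w))%:E)%E.
  rewrite [RHS]integral_mkcond; apply: eq_integral => y _.
  rewrite /f /= patchE indicE; case: ifP => _; first by rewrite mulr1.
  by rewrite mulr0.
have GE y : (\int[area R]_w f (w, y) = (\1_J y)%:E * \int[area R]_w (G w)%:E)%E.
  rewrite /f /= indicE; have [_|_] := boolP (y \in J) => /=.
    under eq_integral do rewrite mulr1.
    by rewrite mul1e (@integral_rot y (EFin \o G))//; exact/measurable_EFinP.
  under eq_integral do rewrite mulr0.
  by rewrite mul0e integral0.
have fG : (\int[area R]_w (G w)%:E)%E \is a fin_num.
  exact: integrable_fin_num iG.
have H1 := integral12_prod_meas1 if_; have H2 := integral21_prod_meas1 if_.
have mF := measurable_fubini_F if_.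
have RE w : Rintl 0 (pi *+ 2) (fun y => G (rot y w)) = fine (\int[mu]_y f (w, y))%E.
  by rewrite FE.
(* [fine] would send an infinite inner integral to 0; by Fubini the inner integral is finite for
   almost every [w]. *)
have aeF : ae_eq (@area_measure R) setT
    (fun w => (fine (\int[mu]_y f (w, y)))%:E)%E (fun w => \int[mu]_y f (w, y))%E.
  have := ae_integrable1 if_; apply: filterS => w iw _.
  by rewrite fineK// integrable_fin_num.
rewrite {1}/Rintegral; under eq_integral do rewrite RE.
have -> : (\int[area R]_w (fine (\int[mu]_y f (w, y)))%:E =
    \int[@area_measure R]_w (\int[mu]_y f (w, y)))%E.
  apply: (@ae_eq_integral _ _ _ (@area_measure R)) => //.
  apply/measurable_EFinP; exact: measurableT_comp.
rewrite (etrans H1 (esym H2)) /fubini_G.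
under eq_integral do rewrite GE -[X in (_ * X)%E]fineK//.
set c := fine (\int[area R]_w (G w)%:E)%E.
have -> : (\int[mu]_x ((\1_J x)%:E * c%:E) = \int[mu]_(x in J) (cst c%:E) x)%E.
  rewrite [RHS]integral_mkcond; apply: eq_integral => y _.
  by rewrite patchE indicE; case: ifP => _ /=; rewrite ?mul1e ?mul0e.
have -> : (\int[mu]_(x in J) (cst c%:E) x = c%:E * (pi *+ 2)%:E)%E.
  by rewrite -muJ; apply: integral_cst.
by rewrite -EFinM /= mulrC.
Qed.
End rotation_average.

(** * Integrals of radial functions over discs *)

Section radial.
Variable R : realType.
Implicit Types (r s t c e : R).
Local Notation mu := (@lebesgue_measure R).

Definition radius (w : plane R) : R := modulus (to_cplx w).
Definition rball (t : R) : set (plane R) := [set w | radius w < t].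
Definition disc_area : R := fine (area R (rball 1)).

Lemma radiusE w : radius w = Num.sqrt (w.1 ^+ 2 + w.2 ^+ 2).
Proof. by rewrite /radius modulusE. Qed.

Lemma radius_ge0 w : 0 <= radius w.
Proof. exact: modulus_ge0. Qed.

Lemma measurable_radius : measurable_fun setT radius.
Proof.
rewrite (_ : radius = Num.sqrt \o (fun w => w.1 ^+ 2 + w.2 ^+ 2)); last first.
  by apply/funext => w; rewrite radiusE.
apply: measurableT_comp => //.
  by apply: continuous_measurable_fun; exact: sqrt_continuous.
by apply: measurable_funD; apply: measurable_funX.
Qed.

Lemma measurable_rball t : measurable (rball t).
Proof.
rewrite (_ : rball t = setT `&` radius @^-1` `]-oo, t[%classic).
  by apply: measurable_radius => //; exact: measurable_itv.
by rewrite setTI; apply/seteqP; split => w; rewrite /rball /= in_itv.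
Qed.

Lemma area_rball1_lty : (area R (rball 1) < +oo)%E.
Proof.
pose I : set (measurableTypeR R) := `[-1, 1]%classic.
have mI : measurable I by exact: measurable_itv.
have sub : rball 1 `<=` I `*` I.
  move=> w; rewrite /rball /I /= !in_itv /= -!ler_norml => /ltW w1.
  by split; rewrite (le_trans _ w1)//; [exact: (le_Re_modulus (to_cplx w)) |
    exact: (le_Im_modulus (to_cplx w))].
apply: (@le_lt_trans _ _ (area R (I `*` I))).
  by apply: le_measure => //; rewrite inE; [exact: measurable_rball | exact: measurableX].
have muI : mu I = (2 : R)%:E.
  apply: (etrans (lebesgue_measure_itv `[(-1 : R), 1 : R])).
  by rewrite /= lte_fin (lt_trans (ltrN10 R) ltr01) -EFinB opprK.
rewrite product_measure1E//; apply: (@le_lt_trans _ _ ((2 : R)%:E * (2 : R)%:E)%E).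
  by rewrite -muI.
by rewrite -EFinM ltry.
Qed.

Lemma area_rball1 : area R (rball 1) = disc_area%:E.
Proof. by rewrite /disc_area fineK// ge0_fin_numE// area_rball1_lty. Qed.

Lemma area_rball t : 0 <= t -> area R (rball t) = (t ^+ 2 * disc_area)%:E.
Proof.
rewrite le_eqVlt => /predU1P[<-|t0].
  rewrite expr0n mul0r (_ : rball 0 = set0) ?measure0//.
  by apply/seteqP; split => w //=; rewrite /rball /= ltNge radius_ge0.
rewrite EFinM -area_rball1 -(area_scale t0 (measurable_rball t)).
congr (_ * area R _)%E; apply/seteqP.
have E w : radius (affine2 t 0 0 t w) = t * radius w.
  rewrite !radiusE /= !mul0r addr0 add0r !exprMn -mulrDr sqrtrM ?sqr_ge0//.
  by rewrite sqrtr_sqr gtr0_norm.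
by split => w; rewrite /rball /= E gtr_pMr.
Qed.

Lemma disc_area_ge0 : 0 <= disc_area.
Proof. by rewrite fine_ge0. Qed.

Section radial_primitive.
Variables (F : R -> R) (M : R).
Hypothesis cF : forall r, 0 < r < 1 -> {for r, continuous F}.
Hypothesis bF : forall r, 0 <= r < 1 -> `|F r| <= M.

Lemma measurable_radial : measurable_fun (rball 1) (F \o radius).
Proof.
have mF : measurable_fun (`[0, 1[%classic : set (measurableTypeR R)) F.
  apply/measurable_fun_itv_obnd_cbndP.
  apply: subspace_continuous_measurable_fun; first exact: measurable_itv.
  by apply: continuous_in_subspaceT => r; rewrite inE /= in_itv /=; exact: cF.
apply: (measurable_comp _ _ mF); first exact: measurable_itv.
  by move=> _ [w w1 <-]; rewrite /= in_itv /= radius_ge0.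
exact: measurable_funTS measurable_radius.
Qed.

Lemma integrable_radial : (area R).-integrable (rball 1) (EFin \o (F \o radius)).
Proof.
apply: measurable_bounded_integrable; first exact: measurable_rball.
- exact: area_rball1_lty.
- exact: measurable_radial.
- exists M; split; first exact: num_real.
  move=> x Mx w w1 /=; apply: le_trans (ltW Mx).
  by rewrite bF// radius_ge0.
Qed.

Let G t := Rintegral (area R) (rball t) (F \o radius).

Lemma sub_rball s t : s <= t -> rball s `<=` rball t.
Proof. by move=> st w /lt_le_trans; exact. Qed.

Let annulus s t c e : 0 <= s -> s <= t -> t <= 1 ->
  (forall r, s <= r < t -> `|F r - c| <= e) ->
  `|G t - G s - c * (disc_area * (t ^+ 2 - s ^+ 2))|
    <= e * (disc_area * (t ^+ 2 - s ^+ 2)).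
Proof.
move=> s0 st t1 Fc.
pose A := rball t `\` rball s.
have mA : measurable A by apply: measurableD; exact: measurable_rball.
have At : A `<=` rball t by move=> w [].
have A1 : A `<=` rball 1 := subset_trans At (sub_rball t1).
have tE : rball t = rball s `|` A by rewrite setDUK//; exact: sub_rball.
have disj : [disjoint rball s & A] by apply/disj_setPS => w [h [_ /(_ h)]].
have iA : (area R).-integrable A (EFin \o (F \o radius)).
  by apply: integrableS integrable_radial => //; exact: measurable_rball.
have ic (k : R) : (area R).-integrable A (EFin \o (cst k)).
  apply: measurable_bounded_integrable => //.
    apply: le_lt_trans area_rball1_lty.
    by apply: le_measure => //; rewrite inE//; exact: measurable_rball.
  by exists `|k|; split; [exact: num_real|move=> x kx w _; exact: ltW].
have areaA : fine (area R A) = disc_area * (t ^+ 2 - s ^+ 2).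
  have E : ((s ^+ 2 * disc_area)%:E + area R A = (t ^+ 2 * disc_area)%:E)%E.
    rewrite -(area_rball (le_trans s0 st)) -(area_rball s0) tE.
    apply/esym; apply: measureU => //; first exact: measurable_rball.
    exact/disj_set2P.
  have : fine (area R A) = fine ((t ^+ 2 * disc_area)%:E - (s ^+ 2 * disc_area)%:E)%E.
    by rewrite -E addeAC subee// add0e.
  by move=> ->; rewrite -EFinB /=; ring.
have GE : G t = G s + Rintegral (area R) A (F \o radius).
  rewrite /G tE Rintegral_setU//; first exact: measurable_rball.
  rewrite -tE; apply: integrableS integrable_radial; [exact: measurable_rball..|].
  exact: sub_rball.
rewrite GE (addrC (G s)) addrK -areaA.
rewrite -(Rintegral_cst _ mA) -(Rintegral_cst _ mA).
rewrite -(RintegralB mA iA (ic c)).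
have iAc : (area R).-integrable A (EFin \o (fun w => F (radius w) - c)).
  exact: (integrableB mA iA (ic c)).
apply: (le_trans (le_normr_Rintegral mA iAc)); apply: le_Rintegral => //.
- exact: (integrable_norm iAc).
- exact: (ic e).
- by move=> w [wt ws]; apply: Fc; rewrite wt andbT leNgt; apply/negP.
Qed.

Let M0 : 0 <= M.
Proof. by rewrite (le_trans _ (bF (r := 0) _))// lexx ltr01. Qed.

Let lipschitz s t : 0 <= s -> s <= t -> t <= 1 ->
  `|G t - G s| <= 2 * M * disc_area * (t - s).
Proof.
move=> s0 st t1; have := @annulus s t 0 M s0 st t1.
rewrite mul0r subr0 => /(_ _)/le_trans; apply.
  by move=> r /andP[sr rt]; rewrite subr0 bF// (le_trans s0 sr) (lt_le_trans rt t1).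
rewrite subr_sqr; have := disc_area_ge0; have := M0; move: s0 st t1.
move: disc_area M => k m *.
have H : (t - s) * (t + s) <= (t - s) * 2.
  by apply: ler_wpM2l; [rewrite subr_ge0|lra].
rewrite (_ : 2 * m * k * (t - s) = m * (k * ((t - s) * 2))); last by ring.
by rewrite ler_wpM2l// ler_wpM2l.
Qed.

(** The annulus between [r] and [r + t] has area [disc_area * (2 * r * t + t ^+ 2)] up to sign, and
    [F] is close to [F r] on it. *)
Let derivG r : 0 < r < 1 -> is_derive r 1 G (2 * disc_area * (r * F r)).
Proof.
move=> /andP[r0 r1]; apply: (@expansion_is_derive R) => e e0.
have k0 := disc_area_ge0; set k := disc_area in k0 *.
have k31 : 0 < 2 * (3 * k + 1) by rewrite mulr_gt0// ltr_wpDl// mulr_ge0.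
have Mk1 : 0 < 2 * (M * k + 1) by rewrite mulr_gt0// ltr_wpDl// mulr_ge0.
have [d /= d0 dP] : exists2 d : R, 0 < d &
    forall y, `|r - y| < d -> `|F r - F y| <= e / (2 * (3 * k + 1)).
  have /cF/cvgrPdist_le : 0 < r < 1 by rewrite r0.
  by move=> /(_ (e / (2 * (3 * k + 1)))); rewrite divr_gt0// => /(_ isT)[d d0 dP]; exists d.
(* Half of [e] pays for the oscillation of [F] on the annulus and half for the term in [t ^+ 2]; the
   last two bounds keep [r + t] in [0, 1]. *)
exists (Num.min (Num.min d (e / (2 * (M * k + 1)))) (Num.min r (1 - r))).
  by rewrite !lt_min d0 divr_gt0// r0 subr_gt0.
move=> t; rewrite !lt_min => /andP[/andP[td te] /andP[tr t1]].
have rt0 : 0 <= r + t.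
  by move: tr; rewrite ltr_norml -subr_gt0 opprK addrC => /andP[/ltW].
have rt1 : r + t <= 1.
  by rewrite addrC -lerBrDr (le_trans (ler_norm t))// ltW.
have key : `|G (r + t) - G r - F r * (k * ((r + t) ^+ 2 - r ^+ 2))| <=
    e / (2 * (3 * k + 1)) * (k * `|(r + t) ^+ 2 - r ^+ 2|).
  have [t0|t0] := leP 0 t.
    have rr : r <= r + t by rewrite lerDl.
    rewrite (ger0_norm (_ : 0 <= (r + t) ^+ 2 - r ^+ 2)); last first.
      by rewrite subr_ge0 ler_sqr ?nnegrE// ltW.
    apply: annulus => //; first exact: ltW.
    move=> y /andP[ry yr]; rewrite distrC dP// distrC ger0_norm ?subr_ge0//.
    by rewrite (lt_trans _ td)// (ger0_norm t0) ltrBlDl.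
  have rr : r + t <= r by rewrite gerDl ltW.
  rewrite (ler0_norm (_ : (r + t) ^+ 2 - r ^+ 2 <= 0)); last first.
    by rewrite subr_le0 ler_sqr ?nnegrE// ltW.
  rewrite opprB -normrN (_ : - (_ - _) =
    G r - G (r + t) - F r * (k * (r ^+ 2 - (r + t) ^+ 2))); last by ring.
  apply: annulus => //; first exact: ltW.
  move=> y /andP[ry yr]; rewrite distrC dP// ger0_norm ?subr_ge0 1?ltW//.
  rewrite (le_lt_trans _ td)// (ltr0_norm t0) lerBlDr addrC -lerBlDr opprK //.
have sqE : (r + t) ^+ 2 - r ^+ 2 = t * (2 * r + t) by ring.
rewrite sqE normrM in key.
have e1 : e / (2 * (3 * k + 1)) * (k * (`|t| * `|2 * r + t|)) <= e / 2 * `|t|.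
  have r3 : `|2 * r + t| <= 3.
    rewrite mulr_natl mulr2n -addrA ger0_norm; last by rewrite addr_ge0// ltW.
    by apply: (le_trans (lerD (ltW r1) rt1)); rewrite -[1 + 1]/(2%:R) ler_nat.
  apply: (@le_trans _ _ (e / (2 * (3 * k + 1)) * (k * (`|t| * 3)))).
    by rewrite ler_wpM2l ?divr_ge0 ?(ltW e0) ?(ltW k31)// !ler_wpM2l.
  rewrite (_ : _ * (k * _) = e / 2 * `|t| * (3 * k / (3 * k + 1))); last first.
    by field; lra.
  rewrite ler_piMr ?mulr_ge0 ?divr_ge0 ?(ltW e0)//.
  by rewrite ler_pdivrMr; lra.
have e2 : `|F r * (k * t ^+ 2)| <= e / 2 * `|t|.
  rewrite !normrM (ger0_norm k0).
  have Fr : `|F r| <= M by rewrite bF// r1 ltW.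
  apply: (@le_trans _ _ (M * (k * (`|t| * (e / (2 * (M * k + 1))))))).
    rewrite ler_pM// ?mulr_ge0// ler_wpM2l// ler_wpM2l//; exact: ltW.
  rewrite (_ : M * _ = e / 2 * `|t| * (M * k / (M * k + 1))); last first.
    by field; lra.
  rewrite ler_piMr ?mulr_ge0 ?divr_ge0 ?(ltW e0)//.
  by rewrite ler_pdivrMr; lra.
rewrite (_ : _ - _ * t = (G (r + t) - G r - F r * (k * (t * (2 * r + t)))) +
  F r * (k * t ^+ 2)); last by ring.
rewrite (le_trans (ler_normD _ _))// (_ : e * `|t| = e / 2 * `|t| + e / 2 * `|t|).
  by rewrite lerD// (le_trans key).
by field.
Qed.

(** Integration in polar coordinates, with area element [2 * disc_area * r] dr: [G] and
    [2 * disc_area * u] have the same derivative, so the mean value theorem makes their difference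
    constant. *)
Lemma Rintegral_radial u :
  (forall r, 0 < r < 1 -> is_derive r 1 u (r * F r)) ->
  {within `[0, 1], continuous u} ->
  Rintegral (area R) (rball 1) (F \o radius) = 2 * disc_area * (u 1 - u 0).
Proof.
move=> du cu; pose H r := G r - 2 * disc_area * u r.
have dH r : r \in `]0, 1[ -> is_derive r 1 H 0.
  rewrite in_itv /= => r01; have dGr := derivG r01; have dur := du r r01.
  have := is_deriveB dGr (is_deriveZ (2 * disc_area) dur).
  by rewrite [X in is_derive _ _ _ X](subrr (2 * disc_area * (r * F r))).
have cG : {within `[0, 1], continuous G}.
  have Gdist a b : 0 <= a <= 1 -> 0 <= b <= 1 ->
      `|G a - G b| <= 2 * M * disc_area * `|a - b|.
    move=> /andP[a0 a1] /andP[b0 b1]; have [ab|ba] := leP a b.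
      by rewrite distrC (distrC a) (ger0_norm (_ : 0 <= b - a)) ?subr_ge0// lipschitz.
    by rewrite (gtr0_norm (_ : 0 < a - b)) ?subr_gt0// lipschitz// ltW.
  have L0 : 0 <= 2 * M * disc_area by rewrite !mulr_ge0// disc_area_ge0.
  apply/subspace_continuousP => a /=; rewrite in_itv /= => a01.
  apply/cvgrPdist_le => e e0; have L1 : 0 < 2 * M * disc_area + 1 by rewrite ltr_wpDl.
  exists (e / (2 * M * disc_area + 1)); first by rewrite /= divr_gt0.
  move=> b /= ab; rewrite in_itv /= => b01; rewrite (le_trans (Gdist _ _ a01 b01))//.
  move: ab; rewrite ltr_pdivlMr// => /ltW; apply: le_trans.
  by rewrite mulrC ler_wpM2l// lerDl.
have cH : {within `[0, 1], continuous H}.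
  have : {within `[0, 1], continuous (fun r => G r - 2 * disc_area * u r)}.
    move=> r; apply: cvgB; first exact: cG.
    by apply: cvgM; [exact: cvg_cst|exact: cu].
  by [].
have [c _] := MVT ltr01 dH cH.
rewrite mul0r /H => /eqP; rewrite subr_eq0 => /eqP E.
have G0 : G 0 = 0.
  rewrite /G (_ : rball 0 = set0) ?Rintegral_set0//.
  by apply/seteqP; split => w //=; rewrite /rball /= ltNge radius_ge0.
rewrite -/(G 1) mulrBr; move: E; rewrite G0 sub0r => /eqP.
by rewrite subr_eq addrC => /eqP ->.
Qed.
End radial_primitive.
End radial.

(** * Moments of the weight *)

Lemma is_derive_powR (R : realType) (a r : R) : 0 < r ->
  is_derive r 1 (@powR R ^~ a) (a * r `^ (a - 1)).
Proof.
move=> r0; have r0' : r \in `]0, +oo[ by rewrite in_itv /= r0.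
have <- := powR_derive1 a r0'.
by rewrite derive1E; exact/derivableP/derivable_powR.
Qed.

Lemma is_derive1_continuous (R : realType) (f : R -> R) (x D : R) :
  is_derive x 1 f D -> {for x, continuous f}.
Proof. by case=> df _; exact/differentiable_continuous/derivable1_diffP. Qed.

Lemma powR_le1 (R : realType) (r x : R) : 0 <= r <= 1 -> 0 <= x -> r `^ x <= 1.
Proof.
move=> /andP[r0 r1] x0; have := @ge0_ler_powR R x x0 r 1; rewrite powR1.
by apply; rewrite ?nnegrE.
Qed.

(** Young's inequality for the normalized powers [r^s / A] and [r^t / B]; it is the pointwise form
    of Hoelder's inequality between moments [A] and [B]. *)
Lemma young_powR (R : realType) (r s t p q A B : R) :
  0 < r -> 0 < p -> 0 < q -> p^-1 + q^-1 = 1 -> 0 < A -> 0 < B ->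
  (A `^ p^-1 * B `^ q^-1)^-1 * r `^ (s / p + t / q) <=
    r `^ s / A / p + r `^ t / B / q.
Proof.
move=> r0 p0 q0 pq A0 B0.
have pe e M z : 0 < e -> 0 < M -> (r `^ z / M) `^ e^-1 = r `^ (z / e) / M `^ e^-1.
  move=> e0 M0; rewrite powRM ?powR_ge0 ?invr_ge0 1?ltW// -powRrM; congr (_ * _).
  by rewrite -(powR_inv1 (ltW M0)) -powRrM mulN1r powRN.
have pK e M z : 0 < e -> 0 < M -> ((r `^ z / M) `^ e^-1) `^ e = r `^ z / M.
  move=> e0 M0; rewrite -powRrM mulVf ?gt_eqF// powRr1//.
  by rewrite divr_ge0 ?powR_ge0// ltW.
have := conjugate_powR (powR_ge0 (r `^ s / A) p^-1)
  (powR_ge0 (r `^ t / B) q^-1) p0 q0 pq.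
rewrite (pK p A s p0 A0) (pK q B t q0 B0) (pe p A s p0 A0) (pe q B t q0 B0).
apply: le_trans; rewrite powRD; last by rewrite (gt_eqF r0) implybT.
by rewrite [leRHS]mulrACA -invfM [leRHS]mulrC.
Qed.

Section moments.
Variables (R : realType) (lambda : R -> R).
Hypothesis smooth_lambda : smooth01 lambda.
Hypothesis flat_lambda : forall n : nat, deriv01n n lambda 1 = 0.
Implicit Types (r s x y e : R) (k : nat).

Local Notation lam k := (deriv01n k lambda).

Lemma deriv01n_expansion k r e : 0 <= r <= 1 -> 0 < e ->
  exists2 d : R, 0 < d & forall y, 0 <= y <= 1 -> `|r - y| < d ->
    `|lam k y - lam k r - lam k.+1 r * (y - r)| <= e * `|y - r|.
Proof.
move=> r01 e0.
have rI : r \in `[0, 1] by rewrite in_itv.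
have /cvgrPdist_le := @smooth_lambda k r rI.
move=> /(_ e e0) [d /= d0 dP]; exists d => // y y01 ry.
have [->|yr] := eqVneq y r; first by rewrite !subrr mulr0 subr0 normr0 mulr0.
have yr0 : 0 < `|y - r| by rewrite normr_gt0 subr_eq0.
have := dP y ry yr; rewrite /= in_itv /= => /(_ y01).
rewrite -/(deriv01 (lam k) r) => H.
rewrite -(ler_pM2r yr0) -normrM in H; apply: le_trans H.
by rewrite mulrBl /diff_quot divfK ?subr_eq0// distrC.
Qed.

Lemma deriv01n_continuous k : {within `[0, 1], continuous (lam k)}.
Proof.
apply/subspace_continuousP => r /=; rewrite in_itv /= => r01.
apply/cvgrPdist_le => e e0.
have [d d0 dP] := deriv01n_expansion k r01 ltr01.
have D1 : 0 < `|lam k.+1 r| + 1 by rewrite ltr_wpDl.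
exists (Num.min d (e / (`|lam k.+1 r| + 1))).
  by rewrite /= lt_min d0 divr_gt0.
move=> y /=; rewrite lt_min in_itv /= => /andP[yd ye] y01.
have := dP y y01 yd; rewrite mul1r => H.
rewrite distrC -[_ - _](subrK (lam k.+1 r * (y - r))) (le_trans (ler_normD _ _))//.
rewrite normrM; apply: (@le_trans _ _ ((`|lam k.+1 r| + 1) * `|y - r|)).
  by rewrite mulrDl mul1r addrC lerD2l.
by rewrite mulrC -ler_pdivlMr// distrC ltW.
Qed.

Lemma is_derive_deriv01n k r : 0 < r < 1 -> is_derive r 1 (lam k) (lam k.+1 r).
Proof.
move=> /andP[r0 r1]; apply: (@expansion_is_derive R) => e e0.
have r01 : 0 <= r <= 1 by rewrite !ltW.
have [d d0 dP] := deriv01n_expansion k r01 e0.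
exists (Num.min d (Num.min r (1 - r))); first by rewrite !lt_min d0 r0 subr_gt0.
move=> t; rewrite !lt_min => /and3P[td tr t1].
have rtE : r + t - r = t by rewrite addrAC subrr add0r.
have := dP (r + t); rewrite rtE; apply.
  apply/andP; split.
    by move: tr; rewrite ltr_norml -subr_gt0 opprK addrC => /andP[/ltW].
  by rewrite addrC -lerBrDr (le_trans (ler_norm t))// ltW.
by rewrite opprD addrA subrr add0r normrN.
Qed.

Lemma deriv01n_bounded k : exists2 B : R, 0 <= B &
  forall r, 0 <= r <= 1 -> `|lam k r| <= B.
Proof.
have [c _ cP] := EVT_max ler01 (@deriv01n_continuous k).
have [d _ dP] := EVT_min ler01 (@deriv01n_continuous k).
exists (`|lam k c| + `|lam k d|) => [|r r01]; first by rewrite addr_ge0.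
have rI : r \in `[0, 1] by rewrite in_itv.
rewrite ler_norml; apply/andP; split.
  rewrite lerNl (le_trans (y := `|lam k d|))// ?lerDr//.
  by rewrite (le_trans (y := - lam k d)) ?lerN2 ?dP// (le_trans (ler_norm _))// normrN.
by rewrite (le_trans (cP r rI))// (le_trans (ler_norm _))// lerDl.
Qed.

(* [(-1)^k] makes the integrand of the k-th moment nonnegative near the unit
   circle. *)
Definition moment_fun k x r : R := r `^ x * ((-1) ^+ k * lam k r).

Definition moment k x : R :=
  Rintegral (area R) (rball 1) (moment_fun k x \o @radius R).

Lemma moment_fun_continuous k x r : 0 < r < 1 -> {for r, continuous (moment_fun k x)}.
Proof.
move=> r01; have r0 : 0 < r by case/andP: r01.
have d1 := is_derive_powR x r0.
have d2 := is_derive_deriv01n k r01.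
apply: cvgM; first exact: (is_derive1_continuous d1).
by apply: cvgM; [exact: cvg_cst|exact: (is_derive1_continuous d2)].
Qed.

Lemma moment_fun_bounded k x : 0 <= x -> exists2 B : R, 0 <= B &
  forall r, 0 <= r <= 1 -> `|moment_fun k x r| <= r `^ x * B /\ r `^ x * B <= B.
Proof.
move=> x0; have [B B0 BP] := deriv01n_bounded k; exists B => // r r01; split.
  rewrite /moment_fun normrM ger0_norm ?powR_ge0// ler_wpM2l ?powR_ge0//.
  by rewrite normrM normrX normrN1 expr1n mul1r BP.
by rewrite ler_piMl// powR_le1.
Qed.

Lemma integrable_moment k x : 0 <= x ->
  (area R).-integrable (rball 1) (EFin \o (moment_fun k x \o @radius R)).
Proof.
move=> x0; have [B B0 BP] := moment_fun_bounded k x0.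
apply: (@integrable_radial R _ B) => r r01; first exact: moment_fun_continuous.
have r01' : 0 <= r <= 1 by case/andP: r01 => -> /ltW.
by have [] := BP r r01'; exact: le_trans.
Qed.

(** [moment_fun k (x + 2)] is a primitive of [r] times the difference of the two integrands. The
    factor [r] of the area element is the reason for [x + 2] in place of [x + 1]. The primitive
    vanishes at 1 by flatness and at 0 by its positive exponent. *)
Lemma moment_rec k x : 0 <= x -> (x + 2) * moment k x = moment k.+1 (x + 1).
Proof.
move=> x0; have x10 : 0 <= x + 1 by rewrite addr_ge0.
have x20 : 0 <= x + 2 by rewrite addr_ge0.
pose F r := (x + 2) * moment_fun k x r - moment_fun k.+1 (x + 1) r.
pose u := moment_fun k (x + 2).
have [B B0 BP] := moment_fun_bounded k x0.
have [B' B'0 BP'] := moment_fun_bounded k.+1 x10.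
have cF r : 0 < r < 1 -> {for r, continuous F}.
  move=> r01; apply: cvgB; last exact: moment_fun_continuous.
  by apply: cvgM; [exact: cvg_cst|exact: moment_fun_continuous].
have bF r : 0 <= r < 1 -> `|F r| <= (x + 2) * B + B'.
  move=> /andP[r0 /ltW r1]; have r01 : 0 <= r <= 1 by rewrite r0.
  rewrite (le_trans (ler_normB _ _))// lerD//.
    rewrite normrM (ger0_norm x20) ler_wpM2l//.
    by have [] := BP r r01; exact: le_trans.
  by have [] := BP' r r01; exact: le_trans.
have du r : 0 < r < 1 -> is_derive r 1 u (r * F r).
  move=> r01; have r0 : 0 < r by case/andP: r01.
  have d1 := is_derive_powR (x + 2) r0.
  have d2 := is_deriveZ ((-1) ^+ k) (is_derive_deriv01n k r01).
  have d3 := is_deriveM d1 d2.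
  apply: (is_derive_eq d3); rewrite /F /moment_fun /GRing.scale /= exprS.
  have e1 : r `^ (x + 2 - 1) = r * r `^ x.
    by rewrite -[x in RHS](addrK 1) mulr_powRB1 ?ltW ?ltr_wpDl// (_ : x + 2 - 1 = x + 1)//; ring.
  have e2 : r `^ (x + 2) = r * r `^ (x + 1).
    rewrite -(mulr_powRB1 (ltW r0) (_ : 0 < x + 2)) ?ltr_wpDl//.
    by rewrite (_ : x + 2 - 1 = x + 1)//; ring.
  rewrite e1 e2 [X in _ + X * _](_ : _ = (-1) ^+ k * lam k r)//; ring.
have u1 : u 1 = 0 by rewrite /u /moment_fun flat_lambda !mulr0.
have u0 : u 0 = 0 by rewrite /u /moment_fun powR0 ?mul0r// gt_eqF// ltr_wpDl.
have [Bu Bu0 BuP] := moment_fun_bounded k x20.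
have cu : {within `[0, 1], continuous u}.
  apply/continuous_within_itvP => //; split.
  - by move=> r; rewrite in_itv /=; exact: moment_fun_continuous.
  (* Near 0 the exponent [x + 2] is at least 1, so the power is at most [r] and [u] is at most
     [Bu * r] in absolute value. *)
  - rewrite u0; apply/cvgr0Pnorm_le => e e0.
    exists (Num.min 1 (e / (Bu + 1))); first by rewrite /= lt_min ltr01 divr_gt0// ltr_wpDl.
    move=> r /=; rewrite sub0r normrN lt_min => /andP[r1 re] r0.
    have r01 : 0 <= r <= 1 by rewrite ltW// ltW// (le_lt_trans (ler_norm r)).
    have [ur _] := BuP r r01; rewrite (le_trans ur)//.
    have rB : r * (Bu + 1) <= e.
      rewrite -ler_pdivlMr ?ltr_wpDl// ltW// (le_lt_trans (ler_norm r))//.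
    rewrite (le_trans _ rB)// ler_pM ?powR_ge0// ?lerDl//.
    apply: ge1r_powR; first by rewrite r0; case/andP: r01.
    by rewrite (le_trans (ler1n R 2))// lerDr.
  - have c1 : lam k r @[r --> 1^'-] --> lam k 1.
      by have /(continuous_within_itvP _ ltr01)[] := @deriv01n_continuous k.
    rewrite /u /moment_fun; apply: cvgM.
      apply: cvg_at_left_filter; exact: (is_derive1_continuous (is_derive_powR (x + 2) ltr01)).
    by apply: cvgM => //; exact: cvg_cst.
have := Rintegral_radial cF bF du cu; rewrite u1 u0 subrr mulr0.
have i1 := integrable_moment k x0; have i2 := integrable_moment k.+1 x10.
have i3 : (area R).-integrable (rball 1)
    (EFin \o (fun w => (x + 2) * moment_fun k x (radius w))).
  have := @integrableZl _ _ _ (area R) (rball 1) (measurable_rball 1) (x + 2) _ i1.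
  by apply: eq_integrable => //; exact: measurable_rball.
rewrite /F /moment.
rewrite (RintegralB (measurable_rball 1) i3 i2).
rewrite (RintegralZl _ (measurable_rball 1) i1) => /eqP.
by rewrite subr_eq0 => /eqP.
Qed.

Lemma moment_prod k x : 0 <= x ->
  moment k (x + k%:R) = \prod_(j < k) (x + j%:R + 2) * moment 0 x.
Proof.
move=> x0; elim: k => [|k IH]; first by rewrite big_ord0 mul1r addr0.
rewrite big_ord_recr /= mulrAC -IH -natr1 addrA -moment_rec ?addr_ge0//.
by rewrite mulrC.
Qed.

(** * The part of a moment near the unit circle *)

Section tail.
Variables (k : nat) (a : R).
Hypotheses (a0 : 0 < a) (a1 : a < 1).
Hypothesis sign : forall r, a <= r < 1 -> 0 <= (-1) ^+ k * lam k r.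

Let A : set (plane R) := rball 1 `\` rball a.

Let mA : measurable A.
Proof. by apply: measurableD; exact: measurable_rball. Qed.

Definition tail_moment x : R := Rintegral (area R) A (moment_fun k x \o @radius R).

Let iA x : 0 <= x -> (area R).-integrable A (EFin \o (moment_fun k x \o @radius R)).
Proof.
move=> x0; apply: integrableS (integrable_moment k x0) => //.
- exact: measurable_rball.
- by move=> w [].
Qed.

Let annulusP w : A w -> a <= radius w < 1.
Proof. by case=> w1 wa; rewrite w1 andbT leNgt; exact/negP. Qed.

Lemma dist_moment_tail : exists2 B : R, 0 <= B &
  forall x, 0 <= x -> `|moment k x - tail_moment x| <= a `^ x * B.
Proof.
(* Exponent 0 isolates the bound on the derivative of [lambda], so that [B] does not depend on
   [x]. *)
have [B B0 BP] := moment_fun_bounded k (lexx 0).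
exists (B * fine (area R (rball a))) => [|x x0].
  by rewrite mulr_ge0// fine_ge0.
have ab : rball a `<=` rball 1 by apply: sub_rball; exact: ltW.
have ia : (area R).-integrable (rball a) (EFin \o (moment_fun k x \o @radius R)).
  by apply: integrableS (integrable_moment k x0) => //; exact: measurable_rball.
have -> : moment k x - tail_moment x =
    Rintegral (area R) (rball a) (moment_fun k x \o @radius R).
  have tE : rball 1 = rball a `|` A by rewrite setDUK.
  rewrite /moment tE Rintegral_setU//; [by rewrite addrK|exact: measurable_rball| |].
    by rewrite -tE; exact: integrable_moment.
  by apply/disj_setPS => w [h [_ /(_ h)]].
apply: (le_trans (le_normr_Rintegral (measurable_rball a) ia)).
have aay : (area R (rball a) < +oo)%E by rewrite area_rball ?ltry// ltW.
have ic : (area R).-integrable (rball a) (EFin \o cst (a `^ x * B)).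
  apply: measurable_bounded_integrable => //; first exact: measurable_rball.
  by exists `|a `^ x * B|; split; [exact: num_real|move=> y ky w _; exact: ltW].
rewrite mulrA -Rintegral_cst; last exact: measurable_rball.
apply: le_Rintegral => //; first exact: measurable_rball.
  exact: (integrable_norm ia).
move=> w wa; have r01 : 0 <= radius w <= 1.
  by rewrite radius_ge0 ltW// (lt_trans wa).
have [+ _] := BP _ r01; rewrite powRr0 mul1r => H.
rewrite /moment_fun /= normrM ger0_norm ?powR_ge0// ler_pM ?powR_ge0//.
  by apply: ge0_ler_powR; rewrite ?nnegrE ?radius_ge0//; exact: ltW.
by move: H; rewrite /moment_fun powRr0 mul1r.
Qed.

(** [young_powR] is integrated against the nonnegative factor on the annulus, with [A] and [B] the
    two tail moments; its right side then integrates to [p^-1 + q^-1 = 1]. *)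
Lemma tail_moment_hoelder p q s t : 0 < p -> 0 < q -> p^-1 + q^-1 = 1 ->
  0 <= s -> 0 <= t -> 0 < tail_moment s -> 0 < tail_moment t ->
  tail_moment (s / p + t / q) <=
    tail_moment s `^ p^-1 * tail_moment t `^ q^-1.
Proof.
move=> p0 q0 pq s0 t0 Ns Nt.
set Ms := tail_moment s in Ns *; set Mt := tail_moment t in Nt *.
have v0 : 0 <= s / p + t / q by rewrite addr_ge0// divr_ge0// ltW.
have c0 : 0 < Ms `^ p^-1 * Mt `^ q^-1 by rewrite mulr_gt0// powR_gt0.
rewrite -[leRHS]mulr1 -ler_pdivrMl//.
set c := (_ * _)^-1.
pose f w := moment_fun k s (radius w); pose g w := moment_fun k t (radius w).
have i1 := iA s0; have i2 := iA t0; have i0 := iA v0.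
have j1 : (area R).-integrable A (EFin \o (fun w => (p^-1 / Ms) * f w)).
  by have := integrableZl mA (p^-1 / Ms) i1; apply: eq_integrable.
have j2 : (area R).-integrable A (EFin \o (fun w => (q^-1 / Mt) * g w)).
  by have := integrableZl mA (q^-1 / Mt) i2; apply: eq_integrable.
have j0 : (area R).-integrable A
    (EFin \o (fun w => c * moment_fun k (s / p + t / q) (radius w))).
  by have := integrableZl mA c i0; apply: eq_integrable.
have j12 : (area R).-integrable A
    (EFin \o (fun w => (p^-1 / Ms) * f w + (q^-1 / Mt) * g w)).
  exact: (integrableD mA j1 j2).
rewrite -(RintegralZl _ mA i0).
apply: (@le_trans _ _ (Rintegral (area R) A
    (fun w => (p^-1 / Ms) * f w + (q^-1 / Mt) * g w))).
  apply: le_Rintegral => // w /annulusP rw.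
  have r0 : 0 < radius w by case/andP: rw => /(lt_le_trans a0).
  rewrite /f /g /moment_fun; set r := radius w in rw r0 *.
  have W0 := sign rw; set W := _ * lam k r in W0 *.
  rewrite mulrA [leRHS](_ : _ = (r `^ s / Ms / p + r `^ t / Mt / q) * W); last by ring.
  apply: ler_wpM2r => //.
  exact: young_powR.
rewrite (RintegralD mA j1 j2) (RintegralZl _ mA i1) (RintegralZl _ mA i2).
rewrite -[Rintegral _ _ f]/Ms -[Rintegral _ _ g]/Mt.
by rewrite !divfK ?gt_eqF// pq.
Qed.
End tail.
End moments.

(** * The weighted Bergman space of the disc *)

Section complex_measurability.
Variables (R : realType) (Omega : set (Cplx R)).
Implicit Types (f g : Cplx R -> Cplx R).
Local Open Scope complex_scope.

Lemma cmeasurable_id : cmeasurable Omega id.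
Proof.
split; rewrite /to_cplx /=; apply: measurable_funTS.
  exact: measurable_fst.
exact: measurable_snd.
Qed.

Lemma cmeasurable_cst (c : Cplx R) : cmeasurable Omega (cst c).
Proof. by split; exact: measurable_cst. Qed.

Lemma cmeasurableM f g : cmeasurable Omega f -> cmeasurable Omega g ->
  cmeasurable Omega (fun z => f z * g z).
Proof.
move=> [fr fi] [gr gi]; split.
  rewrite (_ : (fun w => _) = (fun w => complex.Re (f (to_cplx w)) * complex.Re (g (to_cplx w)) -
    complex.Im (f (to_cplx w)) * complex.Im (g (to_cplx w)))).
    by apply: measurable_funB; exact: measurable_funM.
  by apply/funext => w; rewrite ReM.
rewrite (_ : (fun w => _) = (fun w => complex.Re (f (to_cplx w)) * complex.Im (g (to_cplx w)) +
  complex.Im (f (to_cplx w)) * complex.Re (g (to_cplx w)))).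
  by apply: measurable_funD; exact: measurable_funM.
by apply/funext => w; rewrite ImM.
Qed.

Lemma cmeasurableB f g : cmeasurable Omega f -> cmeasurable Omega g ->
  cmeasurable Omega (fun z => f z - g z).
Proof.
move=> [fr fi] [gr gi]; split.
  rewrite (_ : (fun w => _) = (fun w => complex.Re (f (to_cplx w)) - complex.Re (g (to_cplx w)))).
    exact: measurable_funB.
  by apply/funext => w; rewrite ReB.
rewrite (_ : (fun w => _) = (fun w => complex.Im (f (to_cplx w)) - complex.Im (g (to_cplx w)))).
  exact: measurable_funB.
by apply/funext => w; rewrite ImB.
Qed.

Lemma cmeasurableX n : cmeasurable Omega (fun z => z ^+ n).
Proof.
elim: n => [|n IH]; first exact: (cmeasurable_cst 1).
have := cmeasurableM cmeasurable_id IH.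
by congr (cmeasurable _ _); apply/funext => z; rewrite exprS.
Qed.

Lemma cmeasurable_modulus_powR (s : R) :
  cmeasurable Omega (fun z => (modulus z `^ s)%:C).
Proof.
split; last exact: measurable_cst.
apply: measurable_funTS.
change (measurable_fun setT ((@powR R ^~ s) \o @radius R)).
by apply: measurableT_comp => //; exact: measurable_radius.
Qed.

Lemma measurable_modulus_sqr f : cmeasurable Omega f ->
  measurable_fun (area_dom Omega) (fun w => modulus (f (to_cplx w)) ^+ 2).
Proof.
move=> [fr fi].
rewrite (_ : (fun w => _) = (fun w => complex.Re (f (to_cplx w)) ^+ 2 +
   complex.Im (f (to_cplx w)) ^+ 2)).
  by apply: measurable_funD; exact: measurable_funX.
apply/funext => w; rewrite modulusE sqr_sqrtr//.
by rewrite addr_ge0// sqr_ge0.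
Qed.

End complex_measurability.

(** * Square integrability, orthogonality and uniqueness of the projection *)

Section weighted_disc.
Variables (R : realType) (mu : Cplx R -> R).
Hypothesis weight_mu : is_weight (@unit_disc R) mu.
Implicit Types (f g h : Cplx R -> Cplx R).
Local Open Scope complex_scope.
Local Notation D := (@unit_disc R).
Local Notation W w := (mu (to_cplx w)).

Let W0 w : rball 1 w -> 0 <= W w.
Proof. by case: weight_mu => + _; exact. Qed.

Let mW : measurable_fun (rball 1) (fun w => W w).
Proof. by case: weight_mu. Qed.

Let mD : measurable (rball 1 : set (plane R)) := measurable_rball 1.

Definition sqr_integrable f : Prop :=
  (area R).-integrable (rball 1) (fun w => (modulus (f (to_cplx w)) ^+ 2 * W w)%:E).

Lemma wLp2P f : wLp D mu 2 f <-> cmeasurable D f /\ sqr_integrable f.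
Proof.
have wE : (\int[area R]_(w in area_dom D)
      (modulus (f (to_cplx w)) `^ 2 * mu (to_cplx w))%:E =
    \int[area R]_(w in rball 1) `|(modulus (f (to_cplx w)) ^+ 2 * W w)%:E|)%E.
  apply: eq_integral => w /set_mem wD; rewrite powR_mulrn ?modulus_ge0//.
  by rewrite gee0_abs// lee_fin mulr_ge0// ?W0// sqr_ge0.
rewrite /wLp /wnorm /= wE; split => -[mf fy]; split => //.
  apply/integrableP; split.
    apply/measurable_EFinP; apply: measurable_funM => //.
    exact: (measurable_modulus_sqr mf).
  by apply: lty_poweRy fy; rewrite invr_eq0 pnatr_eq0.
by case/integrableP: fy => _ fy; exact: poweR_lty.
Qed.

Lemma integrable_Re_mul f g : cmeasurable D f -> cmeasurable D g ->
  sqr_integrable f -> sqr_integrable g ->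
  (area R).-integrable (rball 1)
    (fun w => (complex.Re (f (to_cplx w) * conjc (g (to_cplx w)) * (W w)%:C))%:E).
Proof.
move=> [fr fi] [gr gi] sf sg.
have := integrableD mD sf sg; apply: le_integrable => //.
  apply/measurable_EFinP.
  rewrite (_ : (fun w => _) = (fun w => (complex.Re (f (to_cplx w)) * complex.Re (g (to_cplx w)) +
    complex.Im (f (to_cplx w)) * complex.Im (g (to_cplx w))) * W w)).
    apply: measurable_funM => //.
    by apply: measurable_funD; exact: measurable_funM.
  apply/funext => w; rewrite !ReImE /= mulr0 subr0.
  by case: (g _) => [a b] /=; rewrite mulrN opprK.
move=> w wD; rewrite /= -mulrDl lee_fin [leRHS]ger0_norm; last first.
  by rewrite mulr_ge0 ?W0// addr_ge0// sqr_ge0.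
apply: (le_trans (le_Re_modulus _)); rewrite !modulusM modulus_real ger0_norm ?W0//.
apply: ler_wpM2r; first exact: W0.
have -> : modulus (conjc (g (to_cplx w))) = modulus (g (to_cplx w)).
  by rewrite !modulusE; case: (g _) => [a b] /=; rewrite sqrrN.
have := sqr_ge0 (modulus (f (to_cplx w)) - modulus (g (to_cplx w))).
have := modulus_ge0 (f (to_cplx w)); have := modulus_ge0 (g (to_cplx w)).
by move: (modulus (f _)) (modulus (g _)) => a b; nra.
Qed.

Lemma sqr_integrableB f g : cmeasurable D f -> cmeasurable D g ->
  sqr_integrable f -> sqr_integrable g -> sqr_integrable (fun z => f z - g z).
Proof.
move=> mf mg sf sg.
have s2 (k : Cplx R -> Cplx R) : sqr_integrable k ->
    (area R).-integrable (rball 1)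
      (fun w => ((2 : R)%:E * (modulus (k (to_cplx w)) ^+ 2 * W w)%:E))%E.
  by move=> sk; apply: integrableZl.
have := integrableD mD (s2 _ sf) (s2 _ sg); apply: le_integrable => //.
  apply/measurable_EFinP; apply: measurable_funM => //.
  exact: (measurable_modulus_sqr (cmeasurableB mf mg)).
move=> w wD; have p0 z : 0 <= modulus z ^+ 2 * W w.
  by rewrite mulr_ge0 ?sqr_ge0// W0.
rewrite /= lee_fin [leRHS]ger0_norm; last by rewrite addr_ge0// mulr_ge0.
rewrite ger0_norm// !mulrA -mulrDl.
apply: ler_wpM2r; first exact: W0.
have mN : modulus (- g (to_cplx w)) = modulus (g (to_cplx w)).
  by apply: complexI; rewrite -!normC_modulus normrN.
have := ler_modulusD (f (to_cplx w)) (- g (to_cplx w)); rewrite mN.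
have := modulus_ge0 (f (to_cplx w)); have := modulus_ge0 (g (to_cplx w)).
have := modulus_ge0 (f (to_cplx w) - g (to_cplx w)).
have := sqr_ge0 (modulus (f (to_cplx w)) - modulus (g (to_cplx w))).
by move: (modulus (f _)) (modulus (g _)) (modulus (_ - _)) => a b c; nra.
Qed.

Lemma wL2aB f g : wL2a D mu f -> wL2a D mu g -> wL2a D mu (fun z => f z - g z).
Proof.
move=> [hf /wLp2P[mf sf]] [hg /wLp2P[mg sg]]; split.
  by move=> z zD; apply: derivableB; [exact: hf|exact: hg].
by apply/wLp2P; split; [exact: cmeasurableB|exact: sqr_integrableB].
Qed.

Lemma wL2aZ c f : wL2a D mu f -> wL2a D mu (fun z => c * f z).
Proof.
move=> [hf /wLp2P[mf sf]]; split.
  move=> z zD; apply: (@derivableM R[i] (Cplx R) (cst c) f).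
    exact: derivable_cst.
  exact: hf.
apply/wLp2P; split.
  by apply: cmeasurableM => //; exact: cmeasurable_cst.
have := integrableZl mD (modulus c ^+ 2) sf; apply: eq_integrable => //.
by move=> w _; rewrite modulusM exprMn -EFinM mulrA.
Qed.

(** Replacing [h] by ['i * h] turns the imaginary part of the inner product into a real part, so
    only real integrals have to be averaged over rotations. *)
Lemma Re_winner_eq0 u : cmeasurable D u -> sqr_integrable u ->
  (forall h, wL2a D mu h -> complex.Re (winner D mu u h) = 0) ->
  forall h, wL2a D mu h -> winner D mu u h = 0.
Proof.
move=> mu_ su H h hh; apply/eqP; rewrite eq_complex H// eqxx /=.
have /= := H _ (wL2aZ 'i hh); rewrite /winner /= => E; apply/eqP; rewrite -[RHS]E.
apply: eq_Rintegral => w _.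
by case: (u _) (h _) => [a b] [c d]; rewrite !ReImE /=; ring.
Qed.

Lemma wnorm_EFin p f (G : plane R -> R) :
  (area R).-integrable (rball 1) (EFin \o G) ->
  (forall w, rball 1 w -> modulus (f (to_cplx w)) `^ p * W w = G w) ->
  wnorm D mu p f = ((Rintegral (area R) (rball 1) G) `^ p^-1)%:E.
Proof.
move=> iG fG; rewrite -poweR_EFin /wnorm /Rintegral fineK; last first.
  exact: (integrable_fin_num mD iG).
by congr (_ `^ _)%E; apply: eq_integral => w /set_mem wD; rewrite fG.
Qed.

Lemma admissible_point z : admissible D mu -> D z ->
  exists2 C : R, 0 < C & forall f, wL2a D mu f ->
    ((modulus (f z))%:E <= C%:E * wnorm D mu 2 f)%E.
Proof.
move=> adm zD; have cz : compact [set z] by exact: compact_set1.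
have sz : [set z] `<=` D by move=> _ ->.
by have [C [C0 CP]] := adm _ cz sz; exists C => // f fa; exact: CP.
Qed.

(** The difference [d] of two candidates lies in the Bergman space and is orthogonal to itself,
    hence has norm 0. Admissibility turns this into equality at every point of the disc. *)
Lemma bergman_proj_unique f g1 g2 : admissible D mu ->
  cmeasurable D f -> sqr_integrable f ->
  is_bergman_proj D mu f g1 -> is_bergman_proj D mu f g2 ->
  forall z, D z -> g1 z = g2 z.
Proof.
move=> adm mf sf [g1a o1] [g2a o2] z zD.
have da := wL2aB g1a g2a; set d := (fun z => _) in da.
have [_ /wLp2P[m1 s1]] := g1a; have [_ /wLp2P[m2 s2]] := g2a.
have [_ /wLp2P[md sd]] := da.
have i1 := integrable_Re_mul (cmeasurableB mf m1) md (sqr_integrableB mf m1 sf s1) sd.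
have i2 := integrable_Re_mul (cmeasurableB mf m2) md (sqr_integrableB mf m2 sf s2) sd.
have : Rintegral (area R) (rball 1) (fun w => modulus (d (to_cplx w)) ^+ 2 * W w) = 0.
  have /(congr1 (@complex.Re R)) /= r1 := o1 _ da.
  have /(congr1 (@complex.Re R)) /= r2 := o2 _ da.
  rewrite -[RHS](subrr 0) -{1}r2 -r1.
  rewrite -(RintegralB mD i2 i1); apply: eq_Rintegral => w _.
  rewrite modulusE sqr_sqrtr ?addr_ge0 ?sqr_ge0// /d.
  by case: (f _) (g1 _) (g2 _) => [? ?] [? ?] [? ?]; rewrite !ReImE /=; ring.
move=> I0; have [K K0 KP] := admissible_point adm zD; have := KP _ da.
rewrite (@wnorm_EFin 2 d _ sd) => [|w _]; last by rewrite powR_mulrn ?modulus_ge0.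
rewrite I0 powR0 ?invr_eq0 ?pnatr_eq0// -EFinM mulr0 lee_fin => d0.
apply/eqP; rewrite -subr_eq0 -modulus_eq0 -/(d z).
by apply/eqP/le_anti; rewrite d0 modulus_ge0.
Qed.

End weighted_disc.

(** With [v] a power of the variable, this turns an inner product into the quotient whose circle
    means are independent of the radius. *)
Lemma Re_mul_conj (R : realType) (v h : Cplx R) : v != 0 ->
  complex.Re (v * conjc h) = modulus v ^+ 2 * complex.Re (h / v).
Proof.
move=> v0; have : 0 < modulus v by rewrite lt_neqAle modulus_ge0 eq_sym modulus_eq0 v0.
rewrite modulusE sqrtr_gt0 => m0; rewrite sqr_sqrtr ?(ltW m0)//.
case: v v0 m0 => a b _ /= m0; case: h => c d.
rewrite !ReImE /=; field.
by rewrite gt_eqF.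
Qed.

(** Applied with [X], [Y], [M] the moments of exponents pn, qn, 2n: [Y / M] is the coefficient of
    the projection of the test function, and [Y] the p-th power of the norm of that function. *)
Lemma conjugate_power_bound (R : realType) (p q X Y M C : R) :
  0 < p -> p^-1 + q^-1 = 1 -> 0 <= X -> 0 < Y -> 0 < M ->
  ((Y / M) `^ p * X) `^ p^-1 <= C * Y `^ p^-1 ->
  X `^ p^-1 * Y `^ q^-1 <= C * M.
Proof.
move=> p0 pq X0 Y0 M0; have YM : 0 < Y / M by rewrite divr_gt0.
have Yp : 0 < Y `^ p^-1 by rewrite powR_gt0.
rewrite powRM ?powR_ge0// -powRrM divff ?(gt_eqF p0)// powRr1 ?(ltW YM)//.
rewrite mulrAC ler_pdivrMr// => H.
have YE : Y = Y `^ p^-1 * Y `^ q^-1.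
  by rewrite -powRD ?pq ?oner_eq0// powRr1// ltW.
by rewrite -(ler_pM2l Yp) mulrCA -YE mulrC mulrCA mulrA.
Qed.

(** * Projections of radial multiples of monomials *)

Section radial_weight.
Variables (R : realType) (mu : Cplx R -> R) (lambda : R -> R).
Hypothesis weight_mu : is_weight (@unit_disc R) mu.
Hypothesis radial_mu : forall z : Cplx R, unit_disc z -> mu z = lambda (modulus z).
Hypothesis smooth_lambda : smooth01 lambda.
Implicit Types (x y b c s : R) (n : nat).
Local Open Scope complex_scope.
Local Notation D := (@unit_disc R).
Local Notation mom := (moment lambda 0).
Local Notation mfun x := (moment_fun lambda 0 x \o @radius R).

Let mD : measurable (rball 1 : set (plane R)) := measurable_rball 1.

Let mfunE x w : rball 1 w ->
  modulus (to_cplx w) `^ x * mu (to_cplx w) = moment_fun lambda 0 x (radius w).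
Proof.
move=> w1; rewrite radial_mu// /moment_fun expr0.
by rewrite [in RHS]mul1r.
Qed.

Let mfun_ge0 x w : rball 1 w -> 0 <= moment_fun lambda 0 x (radius w).
Proof. by move=> w1; rewrite -mfunE// mulr_ge0 ?powR_ge0//; apply weight_mu.1. Qed.

Lemma moment0_ge0 x : 0 <= mom x.
Proof. by apply: Rintegral_ge0 => w; exact: mfun_ge0. Qed.

Lemma moment0_le x y : 0 <= x -> x <= y -> mom y <= mom x.
Proof.
move=> x0 xy; apply: le_Rintegral => //.
- exact: (@integrable_moment R lambda smooth_lambda 0%N y (le_trans x0 xy)).
- exact: (@integrable_moment R lambda smooth_lambda 0%N x x0).
move=> w w1; rewrite -!mfunE// ler_wpM2r//; first by apply weight_mu.1.
(* At the centre 0 to the power 0 is 1, so the two powers are compared separately there. *)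
have := modulus_ge0 (to_cplx w); rewrite le_eqVlt => /predU1P[<-|m0].
  have [->//|y0] := eqVneq y x; have yx : x < y by rewrite lt_neqAle xy eq_sym y0.
  by rewrite powR0 ?powR_ge0// gt_eqF// (le_lt_trans x0).
apply: ger_powR => //.
by rewrite m0 /=; exact: ltW.
Qed.

Lemma sqr_integrable_power f x : 0 <= x ->
  (forall z, modulus (f z) ^+ 2 = modulus z `^ x) -> sqr_integrable mu f.
Proof.
move=> x0 fE; have := @integrable_moment R lambda smooth_lambda 0%N x x0.
apply: eq_integrable => // w /set_mem w1; rewrite fE.
by rewrite (mfunE x w1).
Qed.

Lemma wnorm_power p f C x : 0 <= x ->
  (forall z, D z -> modulus (f z) `^ p = C * modulus z `^ x) ->
  wnorm D mu p f = ((C * mom x) `^ p^-1)%:E.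
Proof.
move=> x0 fE; have iM := @integrable_moment R lambda smooth_lambda 0%N x x0.
rewrite (@wnorm_EFin R mu p f (fun w => C * mfun x w)).
- by rewrite RintegralZl.
- have := integrableZl mD C iM.
  by apply: eq_integrable.
- by move=> w w1; rewrite fE// -mulrA (mfunE x w1).
Qed.

Let modulus_sqrX z n : modulus (z ^+ n : Cplx R) ^+ 2 = modulus z `^ (2 * n)%:R.
Proof. by rewrite modulusX -exprM mulnC powR_mulrn// modulus_ge0. Qed.

Lemma power_wL2a n : wL2a D mu (fun z => z ^+ n).
Proof.
split; first by move=> z _; exact: exprn_derivable.
apply/(wLp2P weight_mu); split; first exact: cmeasurableX.
by apply: (@sqr_integrable_power _ (2 * n)%:R) => // z; exact: modulus_sqrX.
Qed.

(** Point evaluation at [b] is bounded, and applied to the monomial [z ^+ n] it bounds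
    [b ^+ (2 * n)] by a multiple of the moment of exponent 2n. *)
Lemma moment0_lower b : admissible D mu -> 0 < b < 1 ->
  exists2 c, 0 < c & forall x, 0 <= x -> c * b `^ x <= mom x.
Proof.
move=> adm /andP[b0 b1].
have Db : D b%:C by rewrite /unit_disc /mkset modulus_real gtr0_norm.
have [C C0 CP] := admissible_point adm Db.
exists (b ^+ 2 / C ^+ 2) => [|x x0]; first by rewrite divr_gt0// exprn_gt0.
(* This gives [x <= 2 * n <= x + 2]: moments decrease in the exponent, and the excess of at most 2
   is the factor [b ^+ 2] in the constant. *)
pose n := (Num.trunc (x / 2)).+1.
have x20 : 0 <= x / 2 by rewrite divr_ge0.
have /andP[n1 n2] := truncn_itv x20.
have xn : x <= (2 * n)%:R by rewrite natrM mulrC -ler_pdivrMr// ltW.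
have nx : (2 * n)%:R <= x + 2.
  by rewrite mulnS natrD addrC lerD2r natrM mulrC -ler_pdivlMr.
have bn : b `^ (x + 2) <= C ^+ 2 * mom (2 * n)%:R.
  have := CP _ (power_wL2a n).
  rewrite (@wnorm_power 2 _ 1 (2 * n)%:R)//; last first.
    by move=> z _; rewrite mul1r powR_mulrn ?modulus_ge0// modulus_sqrX.
  rewrite mul1r -EFinM lee_fin modulusX modulus_real gtr0_norm// => H.
  rewrite (@le_trans _ _ ((b ^+ n) ^+ 2))//.
    rewrite -exprM mulnC -powR_mulrn ?(ltW b0)//; apply: ger_powR => //.
    by rewrite b0 ltW.
  have bn0 : 0 <= b ^+ n by rewrite exprn_ge0// ltW.
  have := @lerXn2r R 2 _ _ _ _ H; rewrite !nnegrE exprMn.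
  rewrite -[X in _ -> _ -> (_ <= _ * X)]powR_mulrn ?powR_ge0// -powRrM.
  rewrite mulVf// powRr1 ?moment0_ge0//; apply => //.
  by rewrite mulr_ge0 ?powR_ge0// ltW.
rewrite mulrAC ler_pdivrMr ?exprn_gt0// [leRHS]mulrC.
apply: le_trans (ler_wpM2l _ (moment0_le x0 xn)); last by rewrite exprn_ge0// ltW.
apply: le_trans bn; rewrite powRD; last by rewrite (gt_eqF b0) implybT.
by rewrite powR_mulrn ?(ltW b0)// mulrC.
Qed.

(** Averaging the integrand over rotations leaves the radial function [K] times an integral of
    [Re (h z / z ^+ n)] over a circle. That integral is the same for all circles, so the inner
    product is a multiple of the integral of [K]. *)
Lemma Re_winner_radial n (g : R -> R) h : (0 < n)%N ->
  let u z := z ^+ n * (g (modulus z))%:C in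
  cmeasurable D u -> sqr_integrable mu u ->
  (area R).-integrable (rball 1)
    (EFin \o (fun w => g (radius w) * (radius w ^+ (2 * n) * mu (to_cplx w)))) ->
  Rintegral (area R) (rball 1)
    (fun w => g (radius w) * (radius w ^+ (2 * n) * mu (to_cplx w))) = 0 ->
  wL2a D mu h -> complex.Re (winner D mu u h) = 0.
Proof.
move=> n0 u mu_ su iK K0 ha.
have [hh /(wLp2P weight_mu)[mh sh]] := ha.
pose F (w : plane R) := complex.Re (u (to_cplx w) * conjc (h (to_cplx w)) * (mu (to_cplx w))%:C).
pose K (w : plane R) := g (radius w) * (radius w ^+ (2 * n) * mu (to_cplx w)).
have iF : (area R).-integrable (rball 1) (EFin \o F).
  exact: (integrable_Re_mul weight_mu mu_ mh su sh).
change (Rintegral (area R) (rball 1) F = 0).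
have iG : (area R).-integrable setT (EFin \o (F \_ (rball 1))).
  have := (integrable_mkcond (EFin \o F) mD).1 iF.
  by rewrite restrict_EFin.
have w0D : D (2^-1)%:C.
  by rewrite /unit_disc /mkset modulus_real gtr0_norm ?invf_lt1// ltr1n.
have w00 : (2^-1)%:C != 0 :> Cplx R.
  by rewrite -modulus_eq0 modulus_real normr_eq0 invr_eq0.
(* The circle of radius 1/2 stands for all circles about 0 in the disc. *)
pose A : R := Rintl 0 (pi *+ 2) (fun y =>
  complex.Re (h (cis y * (2^-1)%:C) / (cis y * (2^-1)%:C) ^+ n)).
have radius_rot y w : radius (rot y w) = radius w.
  by rewrite /radius to_cplx_rot modulusM modulus_cis mul1r.
have Rintl0 : Rintl 0 (pi *+ 2) (fun=> 0 : R) = 0.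
  by rewrite /Rintl /Rintegral integral0.
have avg w : Rintl 0 (pi *+ 2) (fun y => (F \_ (rball 1)) (rot y w)) = A * (K \_ (rball 1)) w.
  have [w1|w1] := boolP (w \in rball 1); last first.
    rewrite [X in _ = A * X]patchE (negbTE w1) mulr0.
    transitivity (Rintl 0 (pi *+ 2) (fun=> 0 : R)); last exact: Rintl0.
    congr Rintl; apply/funext => y; rewrite patchE ifF//; apply/negbTE.
    by move: w1; rewrite !notin_setE /rball /mkset radius_rot.
  rewrite [X in _ = A * X]patchE w1.
  have rw1 y : rot y w \in rball 1.
    by move: w1; rewrite !inE /rball /mkset radius_rot.
  have {rw1} -> : (fun y => (F \_ (rball 1)) (rot y w)) = (fun y => F (rot y w)).
    by apply/funext => y; rewrite patchE rw1.
  move: w1; rewrite inE => w1.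
  (* The origin lies on no circle; there [0 < n] makes both sides vanish. *)
  have [z0|z0] := eqVneq (to_cplx w) 0.
    have r0 : radius w = 0 by rewrite /radius z0 modulus0.
    rewrite /K r0 expr0n muln_eq0 /= (gtn_eqF n0) mul0r !mulr0.
    transitivity (Rintl 0 (pi *+ 2) (fun=> 0 : R)); last exact: Rintl0.
    congr Rintl; apply/funext => y.
    by rewrite /F to_cplx_rot z0 mulr0 /u expr0n (gtn_eqF n0) !mul0r.
  have FE y : F (rot y w) = K w * complex.Re (h (cis y * to_cplx w) / (cis y * to_cplx w) ^+ n).
    rewrite /F to_cplx_rot; set v := cis y * _.
    have vm : modulus v = radius w by rewrite /v modulusM modulus_cis mul1r.
    have v0 : v ^+ n != 0 by rewrite expf_neq0// -modulus_eq0 vm modulus_eq0.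
    have -> : mu v = mu (to_cplx w) by rewrite !radial_mu// /unit_disc /mkset vm.
    rewrite /u vm.
    have ReE (a b : Cplx R) (x y' : R) :
        complex.Re (a * x%:C * b * y'%:C) = x * y' * complex.Re (a * b).
      by rewrite !ReImE /=; ring.
    rewrite ReE Re_mul_conj// modulusX vm -exprM mulnC /K.
    by rewrite mulrA -(mulrA (g _)) (mulrC (mu _)).
  pose Q y : R := complex.Re (h (cis y * to_cplx w) / (cis y * to_cplx w) ^+ n).
  have iQ : (@lebesgue_measure R).-integrable `[0, 0 + pi *+ 2] (EFin \o Q).
    by apply: continuous_itv_integrable => y _; exact: holomorphic_circle_continuous.
  have QE : Rintl 0 (pi *+ 2) Q = A by exact: (holomorphic_circle_mean n hh w1 w0D z0 w00).
  have -> : (fun y => F (rot y w)) = (fun y => K w * Q y) by apply/funext.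
  transitivity (K w * Rintl 0 (pi *+ 2) Q); last by rewrite QE mulrC.
  by apply: RintegralZl.
have := Rintegral_rotation_average iG.
under eq_Rintegral do rewrite avg.
have iKp : (area R).-integrable setT (EFin \o (K \_ (rball 1))).
  have := (integrable_mkcond (EFin \o K) mD).1 iK.
  by rewrite restrict_EFin.
move=> E; apply/eqP; have := E.
rewrite (RintegralZl A measurableT iKp) -!Rintegral_mkcond K0 mulr0.
by move=> /esym/eqP; rewrite mulf_eq0 mulrn_eq0/= gt_eqF ?pi_gt0.
Qed.

(** The coefficient is the one for which the radial integral of [Re_winner_radial], here
    [mom (2n + s) - c * mom (2n)], is zero. *)
Lemma bergman_power n s : admissible D mu -> (0 < n)%N -> 0 < n%:R + s ->
  0 < mom (2 * n)%:R ->
  let f z := z ^+ n * (modulus z `^ s)%:C in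
  sqr_integrable mu f ->
  forall z, D z ->
    bergman_proj D mu f z = (mom ((2 * n)%:R + s) / mom (2 * n)%:R)%:C * z ^+ n.
Proof.
move=> adm n0 ns m0 f sf; set c := _ / _.
have mf : cmeasurable D f.
  by apply: cmeasurableM; [exact: cmeasurableX|exact: cmeasurable_modulus_powR].
have pc : wL2a D mu (fun z => c%:C * z ^+ n) by exact: (wL2aZ weight_mu _ (power_wL2a n)).
have [_ /(wLp2P weight_mu)[mc sc]] := pc.
have P : is_bergman_proj D mu f (fun z => c%:C * z ^+ n).
  split=> //; apply: (Re_winner_eq0 weight_mu); first exact: cmeasurableB.
    exact: sqr_integrableB.
  move=> h ha.
  have uE : (fun z => f z - c%:C * z ^+ n) = (fun z => z ^+ n * (modulus z `^ s - c)%:C).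
    by apply/funext => z; rewrite /f rmorphB/= mulrBr [c%:C * _]mulrC.
  rewrite uE.
  have n2s : 0 < (2 * n)%:R + s by rewrite mul2n -addnn natrD -addrA ltr_wpDl.
  have KE w : rball 1 w -> (radius w `^ s - c) * (radius w ^+ (2 * n) * mu (to_cplx w)) =
    moment_fun lambda 0 ((2 * n)%:R + s) (radius w) - c * moment_fun lambda 0 (2 * n)%:R (radius w).
    move=> w1; rewrite -!mfunE// powRD ?powR_mulrn ?modulus_ge0// ?(gt_eqF n2s)//.
        by rewrite mulrBl mulrA [_ `^ s * _]mulrC.
  have iM x : 0 <= x -> (area R).-integrable (rball 1) (EFin \o mfun x).
    exact: integrable_moment.
  have i1 := iM _ (ltW n2s).
  have i2 := integrableZl mD c (iM (2 * n)%:R (ler0n _ _)).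
    apply: (@Re_winner_radial n (fun r => r `^ s - c) h) => //; rewrite -?uE.
  - exact: cmeasurableB.
  - exact: sqr_integrableB.
  - have := integrableB mD i1 i2.
    by apply: eq_integrable => // w /set_mem w1 /=; rewrite KE.
  - rewrite (@eq_Rintegral _ _ _ _ _
      (fun w => mfun ((2 * n)%:R + s) w - c * mfun (2 * n)%:R w)); last first.
      by move=> w /set_mem; exact: KE.
    rewrite RintegralB// RintegralZl//; last exact: iM.
    by rewrite -!/(moment _ _ _) /c divfK ?subrr// gt_eqF.
move=> z Dz; apply: (bergman_proj_unique weight_mu adm mf sf _ P Dz).
by apply: (@xgetPex _ _ [set g | is_bergman_proj D mu f g]); exists (fun z => c%:C * z ^+ n).
Qed.

Lemma bergman_bounded_moment p q : admissible D mu -> 1 < p -> 1 < q ->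
  p^-1 + q^-1 = 1 -> bergman_bounded D mu p ->
  exists2 C : R, 0 < C & forall n, (0 < n)%N ->
    mom (p * n%:R) `^ p^-1 * mom (q * n%:R) `^ q^-1 <= C * mom (2 * n)%:R.
Proof.
move=> adm p1 q1 pq [C [C0 CP]]; exists C => // n n0.
have p0 : 0 < p by exact: lt_trans p1.
have q0 : 0 < q by exact: lt_trans q1.
have n0' : 0 < n%:R :> R by rewrite ltr0n.
have pqE : p * (q - 1) = q.
  have p0' := gt_eqF p0; have q0' := gt_eqF q0.
  rewrite mulrBr mulr1; have := congr1 (fun x => p * q * x) pq.
  rewrite mulrDr mulr1 mulrAC mulfV ?p0'// mul1r -mulrA mulfV ?q0'// mulr1 => <-.
  by rewrite addrK.
have mom0 x : 0 <= x -> 0 < mom x.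
  have h01 : 0 < (2^-1 : R) < 1 by rewrite invr_gt0 ltr0n invf_lt1 ?ltr1n.
  have [c c0 cP] := moment0_lower adm h01.
  by move=> x0; apply: lt_le_trans (cP _ x0); rewrite mulr_gt0// powR_gt0 invr_gt0.
(* Then [n + s = n (q - 1)] and [p (q - 1) = q], so the p-th power of the modulus of [f] is that of
   [z] to the power qn. Also [2n + s = qn], so the same moment appears in the coefficient of the
   projection. *)
pose s := n%:R * (q - 2).
pose f (z : Cplx R) : Cplx R := z ^+ n * (modulus z `^ s)%:C.
have nsE : n%:R + s = n%:R * (q - 1) by rewrite /s; ring.
have ns : 0 < n%:R + s by rewrite nsE mulr_gt0// subr_gt0.
have fm z : modulus (f z) = modulus z `^ (n%:R + s).
  rewrite /f modulusM modulusX modulus_real ger0_norm ?powR_ge0//.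
  by rewrite powRD ?powR_mulrn ?modulus_ge0// (gt_eqF ns).
have qn0 : 0 <= q * n%:R by rewrite mulr_ge0// ltW.
have pn0 : 0 <= p * n%:R by rewrite mulr_ge0// ltW.
have mf : cmeasurable D f.
  by apply: cmeasurableM; [exact: cmeasurableX|exact: cmeasurable_modulus_powR].
have sf : sqr_integrable mu f.
  apply: (@sqr_integrable_power f ((n%:R + s) * 2)) => [|z]; first by rewrite mulr_ge0// ltW.
  by rewrite fm powRrM powR_mulrn// powR_ge0.
have f2 : wLp D mu 2 f by exact/(wLp2P weight_mu).
have fpE z : D z -> modulus (f z) `^ p = 1 * modulus z `^ (q * n%:R).
  by move=> _; rewrite fm -powRrM mul1r nsE -mulrA [_ * p]mulrC pqE mulrC.
have nf := wnorm_power qn0 fpE.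
have fp : wLp D mu p f by split; rewrite ?nf ?ltry.
have := CP f f2 fp; rewrite nf mul1r.
have m2 : 0 < mom (2 * n)%:R by exact: mom0.
have nqE : (2 * n)%:R + s = q * n%:R by rewrite natrM /s; ring.
pose c := mom (q * n%:R) / mom (2 * n)%:R.
have c0 : 0 < c by apply: divr_gt0; [exact: mom0 qn0|exact: m2].
have gpE z : D z -> modulus (bergman_proj D mu f z) `^ p = c `^ p * modulus z `^ (p * n%:R).
  move=> Dz; rewrite (@bergman_power n s)// nqE modulusM modulus_real gtr0_norm//.
  rewrite modulusX powRM ?exprn_ge0 ?modulus_ge0 ?(ltW c0)//.
  by rewrite -powR_mulrn ?modulus_ge0// -powRrM [_ * p]mulrC.
rewrite (wnorm_power pn0 gpE) -EFinM lee_fin.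
exact: (conjugate_power_bound p0 pq (moment0_ge0 _) (mom0 _ qn0) m2).
Qed.
End radial_weight.

(** * Asymptotics of the moments *)

Section real_estimates.
Variable R : realType.
Implicit Types (a b c B x p q : R) (k n : nat).

(** [(b / a)^x] is at least [1 + x * ln (b / a)], and linear growth is enough to pass [B / c]. *)
Lemma powR_dominated a b c B : 0 < a -> a < b -> 0 < c ->
  exists X, forall x, X <= x -> a `^ x * B <= c * b `^ x.
Proof.
move=> a0 ab c0; have b0 := lt_trans a0 ab.
have l0 : 0 < ln (b / a) by rewrite ln_gt0// ltr_pdivlMr// mul1r.
exists (B / (c * ln (b / a))) => x; rewrite ler_pdivrMr ?mulr_gt0// => Bx.
have -> : b `^ x = a `^ x * (b / a) `^ x.
  by rewrite -powRM ?ltW ?divr_gt0// mulrC divfK ?gt_eqF.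
rewrite mulrCA ler_pM2l ?powR_gt0//; apply: (le_trans Bx); rewrite mulrCA ler_pM2l//.
rewrite /powR gt_eqF ?divr_gt0//; apply: le_trans (expR_ge1Dx _).
by rewrite lerDr.
Qed.

Lemma ln_lt_subr1 x : 0 < x -> x != 1 -> ln x < x - 1.
Proof.
move=> x0 x1; have lx : ln x != 0 by rewrite ln_eq0.
by rewrite ltrBrDl -[ltRHS]lnK// expR_gt1Dx.
Qed.

(** The tangent bound [ln t <= t - 1] at [p / 2], where it is strict, and at [q / 2], with weights
    [p^-1] and [q^-1]: the right sides add up to [1 - p^-1 - q^-1 = 0]. *)
Lemma conjugate_powR_lt2 p q : 1 < p -> 1 < q -> p^-1 + q^-1 = 1 -> p != 2 ->
  p `^ p^-1 * q `^ q^-1 < 2.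
Proof.
move=> p1 q1 pq p2.
have p0 : 0 < p by exact: lt_trans p1.
have q0 : 0 < q by exact: lt_trans q1.
have lp : ln (p / 2) < p / 2 - 1.
  apply: ln_lt_subr1; first by rewrite divr_gt0.
  by apply: contra p2 => /eqP E; rewrite -[p](@divfK _ 2)// E mul1r.
have lq : ln (q / 2) <= q / 2 - 1.
  have -> : q / 2 = 1 + (q / 2 - 1) by rewrite addrC subrK.
  by rewrite [leRHS]addrAC subrr add0r; apply: le_ln1Dx; rewrite ltrBrDl addrN divr_gt0.
have pi0 : 0 < p^-1 by rewrite invr_gt0.
have qi0 : 0 < q^-1 by rewrite invr_gt0.
have E (r : R) : 0 < r -> r^-1 * (r / 2 - 1) = 2^-1 - r^-1.
  by move=> r0; rewrite mulrBr mulr1 mulrA mulVf ?gt_eqF// mul1r.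
move: lp; rewrite -(ltr_pM2l pi0) E// => lp.
move: lq; rewrite -(ler_pM2l qi0) E// => lq.
move: (ltr_leD lp lq); rewrite !ln_div ?posrE// => H.
rewrite -ltr_ln ?posrE ?mulr_gt0 ?powR_gt0// lnM ?posrE ?powR_gt0// !ln_powR.
by nra.
Qed.

Lemma prod_arith_le k x : 0 <= x -> x ^+ k <= \prod_(j < k) (x + j%:R + 2).
Proof.
move=> x0; rewrite -[in leLHS](card_ord k) -prodr_const; apply: ler_prod => j _.
by rewrite x0 -addrA lerDl addr_ge0.
Qed.

Lemma prod_arith_ge k x : 0 <= x -> \prod_(j < k) (x + j%:R + 2) <= (x + k%:R + 1) ^+ k.
Proof.
move=> x0; rewrite -[X in _ ^+ X](card_ord k) -prodr_const; apply: ler_prod => j _.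
by rewrite !addr_ge0//= -!addrA lerD2l (_ : 2 = 1 + 1)// addrA lerD2r natr1 ler_nat.
Qed.

Lemma prod_arith_ge1 k x : 0 <= x -> 1 <= \prod_(j < k) (x + j%:R + 2).
Proof.
move=> x0; rewrite -[leLHS](expr1n R k) -[in leLHS](card_ord k) -prodr_const.
apply: ler_prod => j _; rewrite ler01/= (_ : 2 = 1 + 1)// addrA lerDr.
by rewrite !addr_ge0.
Qed.

Lemma geometric_unbounded x B : 1 < x -> exists k, B < x ^+ k.
Proof.
move=> x1; have [X XP] := powR_dominated (B + 1) ltr01 x1 ltr01.
exists (Num.bound `|X|); have := XP _ (ltW (le_lt_trans (ler_norm X) (archi_boundP (normr_ge0 X)))).
rewrite powR1 !mul1r powR_mulrn ?(ltW (lt_trans _ x1))//.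
by apply: lt_le_trans; rewrite ltrDl.
Qed.

(** For [r > 1], [r * n + k + 1 <= r * (n + k + 1)], and the conjugate powers of [n + k + 1]
    recombine. Then [(1 + (k + 1) / n) ^+ k] is at most [expR (k * (k + 1) / n)], hence at most
    [expR 1] once [n] is at least [k * (k + 1)]. *)
Lemma stretched_powers p q k n : 1 < p -> 1 < q -> p^-1 + q^-1 = 1 ->
  (0 < n)%N -> (k * k.+1 <= n)%N ->
  (((p * n%:R) + k%:R + 1) ^+ k) `^ p^-1 * (((q * n%:R) + k%:R + 1) ^+ k) `^ q^-1 <=
  (p `^ p^-1 * q `^ q^-1) ^+ k * (n%:R ^+ k * expR 1).
Proof.
move=> p1 q1 pq n0 kn; pose e : R := n%:R + k.+1%:R.
have e0 : 0 < e by rewrite addr_gt0// ltr0n.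
have step (r : R) : 1 < r ->
    ((r * n%:R + k%:R + 1) ^+ k) `^ r^-1 <= (r `^ r^-1) ^+ k * (e `^ r^-1) ^+ k.
  move=> r1; have r0 : 0 < r by exact: lt_trans r1.
  rewrite -exprMn -powRM ?(ltW r0) ?(ltW e0)// -[leRHS]powR_mulrn ?powR_ge0//.
  rewrite powRAC powR_mulrn; last first.
    by rewrite mulr_ge0// ?(ltW r0) ?(ltW e0).
  apply: ge0_ler_powR;
    rewrite ?nnegrE ?exprn_ge0 ?invr_ge0 ?addr_ge0 ?mulr_ge0 ?(ltW r0) ?(ltW e0)//.
  apply: lerXn2r; rewrite ?nnegrE ?addr_ge0 ?mulr_ge0 ?(ltW r0) ?(ltW e0)//.
  by rewrite mulrDr -addrA lerD2l natr1 ler_peMl// ltW.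
apply: (le_trans (ler_pM (powR_ge0 _ _) (powR_ge0 _ _) (step p p1) (step q q1))).
rewrite mulrACA -(exprMn _ (p `^ _)) -(exprMn _ (e `^ _)) -powRD ?pq ?oner_eq0//.
rewrite powRr1 ?(ltW e0)// ler_pM2l; last first.
  by rewrite exprn_gt0// mulr_gt0// powR_gt0// (lt_trans ltr01).
have n0' : 0 < n%:R :> R by rewrite ltr0n.
have -> : e = n%:R * (1 + k.+1%:R / n%:R) by rewrite mulrDr mulr1 mulrC divfK// gt_eqF.
rewrite exprMn ler_pM2l ?exprn_gt0//.
apply: (@le_trans _ _ (expR (k.+1%:R / n%:R) ^+ k)).
  apply: lerXn2r; rewrite ?nnegrE ?expR_ge0 ?addr_ge0 ?divr_ge0//.
  exact: expR_ge1Dx.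
by rewrite -expRM_natl ler_expR mulrA -natrM ler_pdivrMr// mul1r ler_nat.
Qed.
End real_estimates.

Section moment_asymptotics.
Variables (R : realType) (lambda : R -> R).
Hypothesis smooth_lambda : smooth01 lambda.
Hypothesis flat_lambda : forall n : nat, deriv01n n lambda 1 = 0.
Hypothesis sign_lambda : forall n : nat, exists a : R, 0 < a < 1 /\
  forall r : R, a < r < 1 -> 0 <= (-1) ^+ n * deriv01n n lambda r.
Hypothesis lower : forall b : R, 0 < b < 1 ->
  exists2 c : R, 0 < c & forall x : R, 0 <= x -> c * b `^ x <= moment lambda 0 x.
Implicit Types (b c x y s t p q : R) (k n : nat).
Local Notation mom k := (moment lambda k).

(** By [moment_prod] the k-th moment at [x] is at least the 0-th moment at [x - k], and lowering the
    exponent of [b < 1] only helps. *)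
Lemma moment_lower k b : 0 < b < 1 ->
  exists2 c : R, 0 < c & forall x : R, k%:R <= x -> c * b `^ x <= mom k x.
Proof.
move=> b01; have [c c0 cP] := lower b01; exists c => // x kx.
have x0 : 0 <= x - k%:R by rewrite subr_ge0.
have := moment_prod smooth_lambda flat_lambda k x0; rewrite subrK => ->.
have cb := cP _ x0; have /andP[b0 b1] := b01.
rewrite (@le_trans _ _ (mom 0 (x - k%:R)))//.
  apply: le_trans cb; rewrite ler_pM2l//; apply: ger_powR; first by rewrite b0 ltW.
  by rewrite gerBl.
rewrite ler_peMl ?prod_arith_ge1//; apply: le_trans cb.
by rewrite mulr_ge0 ?powR_ge0// ltW.
Qed.

Lemma moment_hoelder k p q : 0 < p -> 0 < q -> p^-1 + q^-1 = 1 ->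
  exists X, forall s t, X <= s -> X <= t ->
    mom k (s / p + t / q) <= 4 * (mom k s `^ p^-1 * mom k t `^ q^-1).
Proof.
move=> p0 q0 pq; have [a' [/andP[a'0 a'1] sgn]] := sign_lambda k.
(* The sign is known only on the open interval, so [a] is taken beyond [a']; [b] is taken beyond [a]
   so that the lower bound in [b^x] beats the error in [a^x]. *)
pose a := (a' + 1) / 2; pose b := (a + 1) / 2.
have a'a : a' < a by rewrite midf_lt.
have a1 : a < 1 by rewrite midf_lt.
have ab : a < b by rewrite midf_lt.
have b1 : b < 1 by rewrite midf_lt.
have a0 := lt_trans a'0 a'a; have b0 := lt_trans a0 ab.
have sgn' r : a <= r < 1 -> 0 <= (-1) ^+ k * deriv01n k lambda r.
  by move=> /andP[ar r1]; apply: sgn; rewrite (lt_le_trans a'a).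
have b01 : 0 < b < 1 by rewrite b0.
have [c c0 cP] := moment_lower k b01.
have [B B0 BP] := dist_moment_tail smooth_lambda k a0 a1.
(* With [c / 2] the error is at most half the moment, so that the moment and its tail are each at
   most twice the other. *)
have c20 : 0 < c / 2 by rewrite divr_gt0.
have [X XP] := powR_dominated B a0 ab c20.
pose T := tail_moment lambda k a.
have TP x : Num.max X k%:R <= x -> [/\ 0 < T x, T x <= 2 * mom k x & mom k x <= 2 * T x].
  rewrite ge_max => /andP[/XP Xx kx]; have x0 := le_trans (ler0n _ k) kx.
  have := BP x x0; rewrite -/(T x); have := cP x kx.
  have := mulr_gt0 c0 (powR_gt0 x b0); move: Xx.
  rewrite mulrAC; set u := c * _; set v := _ * B; set m := mom k x; set w := T x.
  rewrite ler_norml => uv u0 um /andP[h1 h2]; split; lra.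
exists (Num.max X k%:R) => s t Xs Xt.
have X0 : 0 <= Num.max X k%:R by rewrite le_max ler0n orbT.
have s0 := le_trans X0 Xs; have t0 := le_trans X0 Xt.
have [Ts s1 _] := TP s Xs; have [Tt t1 _] := TP t Xt.
have Xv : Num.max X k%:R <= s / p + t / q.
  set m := Num.max _ _ in Xs Xt *.
  have -> : m = m / p + m / q by rewrite -mulrDr pq mulr1.
  by apply: lerD; rewrite ler_pM2r ?invr_gt0.
have [_ _ v2] := TP _ Xv.
(* One factor 2 comes from the left side; the other is the product of the powers [p^-1] and [q^-1]
   of 2 on the right side. *)
apply: (le_trans v2); rewrite (_ : 4 = 2 * 2); last by rewrite -natrM.
rewrite -mulrA ler_pM2l//.
apply: (le_trans (tail_moment_hoelder smooth_lambda a0 sgn' p0 q0 pq s0 t0 Ts Tt)).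
have h (r m w : R) : 0 < r -> 0 < w -> w <= 2 * m -> w `^ r^-1 <= 2 `^ r^-1 * m `^ r^-1.
  move=> r0 w0 wm; have /ltW m0 : 0 < m by rewrite -(pmulr_rgt0 _ (ltr0Sn R 1)) (lt_le_trans w0).
  
  by rewrite -powRM//; apply: ge0_ler_powR; rewrite ?nnegrE ?invr_ge0 ?mulr_ge0 ?(ltW r0) ?(ltW w0).
apply: (le_trans (ler_pM (powR_ge0 _ _) (powR_ge0 _ _) (h _ _ _ p0 Ts s1) (h _ _ _ q0 Tt t1))).
by rewrite mulrACA -powRD ?pq ?oner_eq0// powRr1.
Qed.

Lemma moment_contradiction p q C : 1 < p -> 1 < q -> p^-1 + q^-1 = 1 -> 0 < C ->
  (forall n, (0 < n)%N ->
     mom 0 (p * n%:R) `^ p^-1 * mom 0 (q * n%:R) `^ q^-1 <= C * mom 0 (2 * n)%:R) ->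
  p = 2.
Proof.
move=> p1 q1 pq C0 CP; apply/eqP/negP => /negP p2.
have p0 : 0 < p by exact: lt_trans p1.
have q0 : 0 < q by exact: lt_trans q1.
have := conjugate_powR_lt2 p1 q1 pq p2; set K := _ * _ => K2.
have K0 : 0 < K by rewrite mulr_gt0// powR_gt0.
(* [k] is fixed first, from [C] and [K] alone; [n] is then taken large in terms of [k], both for
   [stretched_powers] and for the threshold [X], which depends on [k]. *)
have [k kP] : exists k, 4 * C * expR 1 < (2 / K) ^+ k.
  by apply: geometric_unbounded; rewrite ltr_pdivlMr// mul1r.
have [X XP] := moment_hoelder k p0 q0 pq.
pose n := (maxn (k * k.+1) (Num.bound `|X|)).+1.
have n0 : (0 < n)%N by [].
have kn : (k * k.+1 <= n)%N by rewrite ltnW// ltnS leq_maxl.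
have n0' : 0 < n%:R :> R by rewrite ltr0n.
have Xn (r : R) : 1 < r -> X <= r * n%:R + k%:R.
  move=> r1; rewrite -[leLHS]addr0 lerD//; apply: (le_trans (ler_norm X)).
  apply: (le_trans (ltW (archi_boundP (normr_ge0 X)))).
  rewrite (@le_trans _ _ n%:R)//; last by rewrite ler_peMl// ltW.
  by rewrite ler_nat ltnW// ltnS leq_maxr.
have pn0 : 0 <= p * n%:R by rewrite mulr_ge0// ltW.
have qn0 : 0 <= q * n%:R by rewrite mulr_ge0// ltW.
(* The common shift [k] survives the weighted mean because the weights add up to 1, so all three
   moments reduce to order 0 with products of the same length. *)
have E : (p * n%:R + k%:R) / p + (q * n%:R + k%:R) / q = (2 * n)%:R + k%:R.
  rewrite !mulrDl addrACA -mulrDr pq mulr1 ![_ * n%:R / _]mulrAC !divff ?gt_eqF//.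
  by rewrite !mul1r mul2n -addnn natrD.
have := XP _ _ (Xn p p1) (Xn q q1).
rewrite E !(moment_prod smooth_lambda flat_lambda)//.
set P2 := \prod_(j < k) _; set M2 := mom 0 _.
set Pp := \prod_(j < k) _; set Mp := mom 0 _.
set Pq := \prod_(j < k) _; set Mq := mom 0 _ => H.
have M20 : 0 < M2.
  have h01 : 0 < (2^-1 : R) < 1 by rewrite invr_gt0 ltr0n invf_lt1 ?ltr1n.
  have [c c0 cP] := lower h01.
  by apply: lt_le_trans (cP _ (ler0n _ _)); rewrite mulr_gt0// powR_gt0// invr_gt0.
have mom_ge0 x : 0 <= x -> 0 <= mom 0 x.
  have h01 : 0 < (2^-1 : R) < 1 by rewrite invr_gt0 ltr0n invf_lt1 ?ltr1n.
  have [c c0 cP] := lower h01.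
  by move=> x0; apply: le_trans (cP _ x0); rewrite mulr_ge0 ?powR_ge0// ltW.
have P20 : (2 * n)%:R ^+ k <= P2 by exact: prod_arith_le.
have Ppk : Pp <= (p * n%:R + k%:R + 1) ^+ k by exact: prod_arith_ge.
have Pqk : Pq <= (q * n%:R + k%:R + 1) ^+ k by exact: prod_arith_ge.
have Pp0 : 0 <= Pp by apply: le_trans (prod_arith_ge1 k pn0).
have Pq0 : 0 <= Pq by apply: le_trans (prod_arith_ge1 k qn0).
have {}H : P2 * M2 <= 4 * (K ^+ k * (n%:R ^+ k * expR 1) * (C * M2)).
  apply: (le_trans H); rewrite ler_pM2l//.
  rewrite !powRM ?mom_ge0// mulrACA.
  apply: ler_pM; rewrite ?mulr_ge0 ?powR_ge0//; last exact: CP.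
  apply: le_trans (stretched_powers p1 q1 pq n0 kn).
  apply: ler_pM; rewrite ?powR_ge0//; apply: ge0_ler_powR => //;
    by rewrite ?nnegrE ?invr_ge0 ?exprn_ge0 ?addr_ge0// ltW.
(* The moment [M2] cancels; cancelling [n%:R ^+ k] as well contradicts the choice of [k]. *)
have : (2 * n)%:R ^+ k <= 4 * (K ^+ k * (n%:R ^+ k * expR 1) * C).
  rewrite -(ler_pM2r M20); apply: le_trans (_ : P2 * M2 <= _); first by rewrite ler_pM2r.
  by apply: (le_trans H); rewrite !mulrA.
rewrite natrM exprMn.
have nk : 0 < n%:R ^+ k :> R by rewrite exprn_gt0.
have Kk : 0 < K ^+ k by rewrite exprn_gt0.
move: kP; rewrite exprMn exprVn ltr_pdivlMr// => kP.
rewrite leNgt => /negP; apply.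
rewrite [X in X < _](_ : _ = 4 * C * expR 1 * K ^+ k * n%:R ^+ k); last by ring.
by rewrite ltr_pM2r.
Qed.
End moment_asymptotics.

Theorem theorem1p2 (R : realType) (mu : Cplx R -> R) (lambda : R -> R)
    (weight_mu : is_weight (@unit_disc R) mu)
    (admissible_mu : admissible (@unit_disc R) mu)
    (radial_mu : forall z : Cplx R, unit_disc z -> mu z = lambda (modulus z))
    (smooth_lambda : smooth01 lambda)
    (flat_lambda : forall n : nat, deriv01n n lambda 1 = 0)
    (sign_lambda : forall n : nat, exists a : R, 0 < a < 1 /\
       forall r : R, a < r < 1 -> 0 <= (-1) ^+ n * deriv01n n lambda r)
    (p : R) (p_gt1 : 1 < p) :
  bergman_bounded (@unit_disc R) mu p -> p = 2.
Proof.
move=> bdd.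
have p0 : 0 < p by exact: lt_trans p_gt1.
have d0 : 0 < p - 1 by rewrite subr_gt0.
pose q : R := p / (p - 1).
have q1 : 1 < q by rewrite /q ltr_pdivlMr// mul1r gtrBl.
have pq : p^-1 + q^-1 = 1.
  by rewrite /q invfM invrK [_^-1 * (p - 1)]mulrC mulrBl mulfV ?gt_eqF// mul1r addrC subrK.
have [C C0 CP] :=
  bergman_bounded_moment weight_mu radial_mu smooth_lambda admissible_mu p_gt1 q1 pq bdd.
apply: (moment_contradiction smooth_lambda flat_lambda sign_lambda _ p_gt1 q1 pq C0 CP).
by move=> b; exact: (moment0_lower weight_mu radial_mu smooth_lambda admissible_mu).
Qed.
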